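(* Let $I$ be the two-sided ideal of $U^{\mathrm{rtt}}_v(L\mathfrak{gl}_n)$ generated by $\{t^+_{11}[s],\,t^-_{11}[-s]\}_{s\geq2}\cup\{t^+_{11}[1]+t^-_{11}[0],\ t^-_{11}[-1]+t^+_{11}[0]\}$. Then $\operatorname{Ker}(\mathrm{ev}^{\mathrm{rtt}})=\mathfrak{U}^{\mathrm{rtt}}_v(L\mathfrak{gl}_n)\cap I$.
   Context: Let $v$ be a formal variable, $E_{ij}$ matrix units of $\operatorname{End}\mathbb{C}^n$. Set $R=v^{-1}\sum_iE_{ii}\otimes E_{ii}+\sum_{i\neq j}E_{ii}\otimes E_{jj}+(v^{-1}-v)\sum_{i>j}E_{ij}\otimes E_{ji}$ and $R_{\mathrm{trig}}(z,w)=(vz-v^{-1}w)\sum_iE_{ii}\otimes E_{ii}+(z-w)\sum_{i\neq j}E_{ii}\otimes E_{jj}+(v-v^{-1})z\sum_{i<j}E_{ij}\otimes E_{ji}+(v-v^{-1})w\sum_{i>j}E_{ij}\otimes E_{ji}$. $\mathfrak{U}^{\mathrm{rtt}}_v(\mathfrak{gl}_n)$ is the associative $\mathbb{C}[v,v^{-1}]$-algebra generated by $\{t^\pm_{ij}\}_{i,j=1}^n$ with relations $t^\pm_{ii}t^\mp_{ii}=1$; $t^+_{ij}=t^-_{ji}=0$ for $j<i$; $RT^+_1T^+_2=T^+_2T^+_1R$, $RT^-_1T^-_2=T^-_2T^-_1R$, $RT^-_1T^+_2=T^+_2T^-_1R$, where $T^\pm=\sum t^\pm_{ij}\otimes E_{ij}$.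 $\mathfrak{U}^{\mathrm{rtt}}_v(L\mathfrak{gl}_n)$ is the associative $\mathbb{C}[v,v^{-1}]$-algebra generated by $\{t^\pm_{ij}[\pm r]\}_{1\leq i,j\leq n}^{r\in\mathbb{N}}$ with relations $t^\pm_{ii}[0]t^\mp_{ii}[0]=1$; $t^+_{ij}[0]=t^-_{ji}[0]=0$ for $j<i$; $R_{\mathrm{trig}}(z,w)T^\epsilon_1(z)T^{\epsilon'}_2(w)=T^{\epsilon'}_2(w)T^{\epsilon}_1(z)R_{\mathrm{trig}}(z,w)$ for $(\epsilon,\epsilon')\in\{(+,+),(-,-),(-,+)\}$, where $T^\pm(z)=\sum_{i,j}t^\pm_{ij}(z)\otimes E_{ij}$, $t^\pm_{ij}(z)=\sum_{r\geq0}t^\pm_{ij}[\pm r]z^{\mp r}$. Set $U^{\mathrm{rtt}}_v(L\mathfrak{gl}_n)=\mathfrak{U}^{\mathrm{rtt}}_v(L\mathfrak{gl}_n)\otimes_{\mathbb{C}[v,v^{-1}]}\mathbb{C}(v)$, into which $\mathfrak{U}^{\mathrm{rtt}}_v(L\mathfrak{gl}_n)$ embeds naturally. The RTT evaluation homomorphism $\mathrm{ev}^{\mathrm{rtt}}\colon\mathfrak{U}^{\mathrm{rtt}}_v(L\mathfrak{gl}_n)\twoheadrightarrow\mathfrak{U}^{\mathrm{rtt}}_v(\mathfrak{gl}_n)$ is the (well-defined, surjective) $\mathbb{C}[v,v^{-1}]$-algebra homomorphism given by $T^+(z)\mapsto T^+-T^-z^{-1}$, $T^-(z)\mapsto T^--T^+z$.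 *)

(* Defs.v *)
(* Presented algebras are handled through their universal
   property: an element of an algebra given by generators and relations is
   represented by a term in the generators, and it vanishes iff its evaluation
   vanishes in every algebra equipped with elements satisfying the relations. *)
From HB Require Import structures.
From mathcomp Require Import all_boot all_order all_algebra.
From mathcomp Require Import fraction.
From mathcomp Require Import complex.
From mathcomp Require Import Rstruct.
Set Implicit Arguments.
Unset Strict Implicit.
Unset Printing Implicit Defensive.
Import Order.TTheory GRing.Theory Num.Theory.
Local Open Scope ring_scope.

Notation CC := (complex Rdefinitions.R).
Definition Cv := {fraction {poly CC}}.
Definition vK : Cv := tofrac ('X : {poly CC}).

Section RTT.
Variable n : nat.

(* Matrix units of End C^n (x) End C^n:
   (E_ij (x) E_kl)_{(p,q),(r,s)} = [p=i][r=j][q=k][s=l]. *)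
Definition EE (i j k l p q r s : 'I_n) : bool :=
  [&& p == i, r == j, q == k & s == l].

Section InRing.
Variable A : pzRingType.
Variables (v vi : A).   (* images of v and v^{-1} *)

Definition bR (b : bool) : A := (b : nat)%:R.

(* entry ((p,q),(r,s)) of
   R = v^{-1} sum_i E_ii(x)E_ii + sum_{i<>j} E_ii(x)E_jj
       + (v^{-1}-v) sum_{i>j} E_ij(x)E_ji *)
Definition Rent (p q r s : 'I_n) : A :=
  vi * (\sum_(i < n) bR (EE i i i i p q r s))
  + (\sum_(i < n) \sum_(j < n | i != j) bR (EE i i j j p q r s))
  + (vi - v) * (\sum_(i < n) \sum_(j < n | (j < i)%N) bR (EE i j j i p q r s)).

(* R_trig(z,w) = z * Rz + w * Rw, where (reading off the defining formula)
   Rz = v sum_i E_ii(x)E_ii + sum_{i<>j} E_ii(x)E_jj + (v-v^{-1}) sum_{i<j} E_ij(x)E_ji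
   Rw = -v^{-1} sum_i E_ii(x)E_ii - sum_{i<>j} E_ii(x)E_jj + (v-v^{-1}) sum_{i>j} E_ij(x)E_ji *)
Definition Rzent (p q r s : 'I_n) : A :=
  v * (\sum_(i < n) bR (EE i i i i p q r s))
  + (\sum_(i < n) \sum_(j < n | i != j) bR (EE i i j j p q r s))
  + (v - vi) * (\sum_(i < n) \sum_(j < n | (i < j)%N) bR (EE i j j i p q r s)).
Definition Rwent (p q r s : 'I_n) : A :=
  - vi * (\sum_(i < n) bR (EE i i i i p q r s))
  - (\sum_(i < n) \sum_(j < n | i != j) bR (EE i i j j p q r s))
  + (v - vi) * (\sum_(i < n) \sum_(j < n | (j < i)%N) bR (EE i j j i p q r s)).

(* Componentwise form of  R X_1 Y_2 = Y_2 X_1 R  for n x n matrices X, Y: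
   entry ((i,k),(j,l)). *)
Definition RTT_rel (X Y : 'I_n -> 'I_n -> A) : Prop :=
  forall i k j l : 'I_n,
    \sum_(a < n) \sum_(b < n) Rent i k a b * (X a j * Y b l)
    = \sum_(a < n) \sum_(b < n) (Y k b * X i a) * Rent a b j l.

Definition fin_rels (tp tm : 'I_n -> 'I_n -> A) : Prop :=
  [/\ forall i, tp i i * tm i i = 1 /\ tm i i * tp i i = 1,
      forall i j : 'I_n, (j < i)%N -> tp i j = 0 /\ tm j i = 0,
      RTT_rel tp tp, RTT_rel tm tm & RTT_rel tm tp].

(* Loop generators: tp i j r = t^+_ij[r], tm i j r = t^-_ij[-r], r : nat.
   Coefficient of z^k (k : int) in T^eps(z)_ij: for eps = + it is t^+_ij[-k]
   (zero if k > 0); for eps = - it is t^-_ij[-k] (zero if k < 0). *)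
Definition coefp (tp : 'I_n -> 'I_n -> nat -> A) (i j : 'I_n) (k : int) : A :=
  match (- k)%R with Posz r => tp i j r | Negz _ => 0 end.
Definition coefm (tm : 'I_n -> 'I_n -> nat -> A) (i j : 'I_n) (k : int) : A :=
  match k with Posz r => tm i j r | Negz _ => 0 end.

(* Coefficient of z^a w^b in
   R_trig(z,w) X_1(z) Y_2(w) = Y_2(w) X_1(z) R_trig(z,w), entry ((i,k),(j,l)),
   where X, Y give the coefficients of the series X(z), Y(w). *)
Definition RTTtrig_rel (X Y : 'I_n -> 'I_n -> int -> A) : Prop :=
  forall (a b : int) (i k j l : 'I_n),
    \sum_(p < n) \sum_(q < n)
       (Rzent i k p q * (X p j (a - 1) * Y q l b)
        + Rwent i k p q * (X p j a * Y q l (b - 1)))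
    = \sum_(p < n) \sum_(q < n)
       ((Y k q b * X i p (a - 1)) * Rzent p q j l
        + (Y k q (b - 1) * X i p a) * Rwent p q j l).

Definition loop_rels (tp tm : 'I_n -> 'I_n -> nat -> A) : Prop :=
  [/\ forall i, tp i i 0%N * tm i i 0%N = 1 /\ tm i i 0%N * tp i i 0%N = 1,
      forall i j : 'I_n, (j < i)%N -> tp i j 0%N = 0 /\ tm j i 0%N = 0,
      RTTtrig_rel (coefp tp) (coefp tp),
      RTTtrig_rel (coefm tm) (coefm tm) &
      RTTtrig_rel (coefm tm) (coefp tp)].

End InRing.

(* Generators of the loop algebra: (true,i,j,r) = t^+_ij[r],
   (false,i,j,r) = t^-_ij[-r]. *)
Definition lgen := (bool * 'I_n * 'I_n * nat)%type.

Definition lassign (A : pzRingType) (tp tm : 'I_n -> 'I_n -> nat -> A)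
  (g : lgen) : A :=
  let: (eps, i, j, r) := g in if eps then tp i j r else tm i j r.

(* The evaluation map on generators:
   T^+(z) |-> T^+ - T^- z^{-1},  T^-(z) |-> T^- - T^+ z. *)
Definition ev_assign (A : pzRingType) (tp0 tm0 : 'I_n -> 'I_n -> A)
  (g : lgen) : A :=
  let: (eps, i, j, r) := g in
  match eps, r with
  | true, 0%N => tp0 i j
  | true, 1%N => - tm0 i j
  | false, 0%N => tm0 i j
  | false, 1%N => - tp0 i j
  | _, _ => 0
  end.

End RTT.

(* Noncommutative polynomial expressions in generators X with coefficients
   in C[v, v^{-1}] (built from constants of C, v and v^{-1}). Every element
   of the free C[v,v^{-1}]-algebra on X is represented by such a term. *)
Inductive term (X : Type) : Type :=
| tGen of X
| tCst of CC
| tV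
| tVinv
| tAdd of term X & term X
| tMul of term X & term X.

Fixpoint teval (X : Type) (A : pzRingType) (cst : CC -> A) (v vi : A)
  (g : X -> A) (t : term X) : A :=
  match t with
  | tGen x => g x
  | tCst c => cst c
  | tV => v
  | tVinv => vi
  | tAdd t1 t2 => teval cst v vi g t1 + teval cst v vi g t2
  | tMul t1 t2 => teval cst v vi g t1 * teval cst v vi g t2
  end.

(* x (an element of 𝔘^rtt_v(Lgl_n), given by a representative term) lies in
   Ker(ev^rtt): its image ev(x) vanishes in 𝔘^rtt_v(gl_n), i.e. in every
   C[v,v^{-1}]-algebra (a C-algebra with a central invertible v) with elements
   satisfying the defining relations of 𝔘^rtt_v(gl_n). *)
Definition in_ker_ev (n : nat) (x : term (lgen n)) : Prop :=
  forall (A : algType CC) (v vi : A) (tp0 tm0 : 'I_n -> 'I_n -> A),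
    (forall a : A, v * a = a * v) -> v * vi = 1 -> vi * v = 1 ->
    fin_rels v vi tp0 tm0 ->
    teval (fun c => c%:A) v vi (ev_assign tp0 tm0) x = 0.

(* The image of x in U^rtt_v(Lgl_n) lies in the two-sided ideal I generated by
   t^+_11[s], t^-_11[-s] (s >= 2), t^+_11[1] + t^-_11[0], t^-_11[-1] + t^+_11[0];
   i.e. x vanishes in U^rtt_v(Lgl_n)/I: in every C(v)-algebra with elements
   satisfying the loop relations and annihilating these generators. *)
Definition in_ideal_I (n : nat) (hn : (0 < n)%N) (x : term (lgen n)) : Prop :=
  let o := Ordinal hn in
  forall (B : algType Cv) (tp tm : 'I_n -> 'I_n -> nat -> B),
    let v := vK%:A in let vi := (vK^-1)%:A in
    loop_rels v vi tp tm ->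
    (forall s : nat, (2 <= s)%N -> tp o o s = 0 /\ tm o o s = 0) ->
    tp o o 1%N + tm o o 0%N = 0 ->
    tm o o 1%N + tp o o 0%N = 0 ->
    teval (fun c : CC => (tofrac (c%:P) : Cv)%:A) v vi (lassign tp tm) x = 0.

(* Main.v *)
(* Kernel into ideal: comparing coefficients of [w^1] and [z^0] in the RTT relations shows that
   every coefficient matrix [X] of [T^+-(z)] satisfies [R X_1 T^+_2 = T^+_2 X_1 R] and
   [R T^-_1 X_2 = X_2 T^-_1 R] with [T^+-] the constant terms.  These relations are linear in
   [X] and force [X = 0] as soon as [X_11 = 0], so modulo [I] the evaluation formulas hold.

   Ideal into kernel: one needs that the evaluation target has no torsion over C[v, v^-1].
   It is spanned, up to the invertible [t^+_aa], by ordered monomials in [t^+_ij] ([i < j]),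
   [t^+_aa - 1] and [t^-_ij] ([i > j]).  These are independent over C(v), as one sees on the
   tensor powers of the vector representation of the same algebra for [gl_(n+1)], restricted
   to [gl_n]: there each of these generators is [v - 1] times an operator defined at [v = 1],
   where it becomes a nonzero multiple of the Lie algebra action of a matrix unit [e_ij].
   The extra basis vector makes a matrix coefficient functional vanish on the identity without
   killing the [e_aa], so that ordered monomials of degree [r] are separated on the [r]-th
   tensor power from each other and from all shorter ones. *)
Require Import Defs.
From HB Require Import structures.
From mathcomp Require Import all_boot all_order all_algebra.
From mathcomp Require Import fraction complex Rstruct mxtens.
From mathcomp Require Import zify ring.
Set Implicit Arguments.
Unset Strict Implicit.
Unset Printing Implicit Defensive.
Import Order.TTheory GRing.Theory Num.Theory.
Local Open Scope ring_scope.

(** * The RTT relations by entries *)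

(** The two conditions quantify over different algebras: the ideal side sees only [C(v)]-algebras,
    while the kernel side includes algebras where [v] acts as 1 or as a root of unity. Vanishing is
    therefore not carried from algebra to algebra but through coefficients. A term, multiplied by a
    product of [t^+_aa], equals a combination of ordered monomials whose Laurent coefficients are
    the same in every algebra ([spanned]). The matrix algebras of the tensor powers are
    [C(v)]-algebras, where the ideal hypothesis applies; they show that these coefficients are zero,
    and zero coefficients give zero everywhere.

    A relation cannot be specialised at [v = 1] directly, because a monomial of degree [s] carries a
    factor [(v - 1)^s] and the longer monomials would be lost. This factor is moved into the
    coefficient, so that monomials of all degrees have comparable limits. The limits being
    independent, every new coefficient is divisible by [v - 1], and the division can be repeated
    until the degree is exhausted. *)

Section RMatrixEntries.
Variables (n : nat) (A : pzRingType).
Implicit Types (v vi : A) (i j k l p q r s : 'I_n) (X Y : 'I_n -> 'I_n -> A).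

Lemma sum_diag_EE p q r s :
  \sum_(i < n) bR A (EE i i i i p q r s) = ((p == q) && (p == r) && (q == s))%:R.
Proof.
rewrite (bigD1 p) //= big1 ?addr0.
  rewrite /bR /EE eqxx /= [r == p]eq_sym [q == p]eq_sym.
  by case: eqP => [->|_]; case: eqP => [<-|_]; rewrite ?andbF //= eq_sym.
by move=> i ip; rewrite /bR /EE [p == i]eq_sym (negPf ip).
Qed.

Lemma sum_offdiag_EE p q r s :
  \sum_(i < n) \sum_(j < n | i != j) bR A (EE i i j j p q r s)
  = ((p != q) && (p == r) && (q == s))%:R.
Proof.
rewrite (bigD1 p) //= [X in _ + X]big1 ?addr0; last first.
  move=> i ip; rewrite big1 // => j _.
  by rewrite /bR /EE [p == i]eq_sym (negPf ip).
have [->|pq] /= := eqVneq p q.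
  by rewrite big1 // => j qj; rewrite /bR /EE (negPf qj) !andbF.
rewrite (bigD1 q) //= big1 ?addr0.
  by rewrite /bR /EE !eqxx /= [r == p]eq_sym [s == q]eq_sym.
move=> j /andP[_ jq]; by rewrite /bR /EE [q == j]eq_sym (negPf jq) !andbF.
Qed.

Lemma sum_swap_EE (P : rel 'I_n) p q r s :
  \sum_(i < n) \sum_(j < n | P i j) bR A (EE i j j i p q r s)
  = (P p q && (p == s) && (q == r))%:R.
Proof.
rewrite (bigD1 p) //= [X in _ + X]big1 ?addr0; last first.
  move=> i ip; rewrite big1 // => j _.
  by rewrite /bR /EE [p == i]eq_sym (negPf ip).
case Ppq : (P p q) => /=.
  rewrite (bigD1 q) //= big1 ?addr0.
    by rewrite /bR /EE !eqxx /= [r == q]eq_sym [s == p]eq_sym andbC.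
  move=> j /andP[_ jq]; by rewrite /bR /EE [q == j]eq_sym (negPf jq) !andbF.
rewrite big1 // => j Pj; rewrite /bR /EE.
by have [E|] := eqVneq q j; rewrite ?andbF //; rewrite E Pj in Ppq.
Qed.

(** [x], [y], [z] weigh the diagonal, off-diagonal and flip parts and [P] selects the flipped pairs,
    so one computation serves both [R] ([q < p]) and [R_z] ([p < q]). *)
Lemma sum_diag_coef (x y z : A) (P : rel 'I_n) (F : 'I_n -> 'I_n -> A) p q :
  \sum_(r < n) \sum_(s < n)
    (x * ((p == q) && (p == r) && (q == s))%:R
     + y * ((p != q) && (p == r) && (q == s))%:R
     + z * (P p q && (p == s) && (q == r))%:R) * F r s
  = (if p == q then x else y) * F p q + (if P p q then z * F q p else 0).
Proof.
transitivity (\sum_(r < n) \sum_(s < n)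
    ((p == r) && (q == s))%:R * ((if p == q then x else y) * F r s)
   + \sum_(r < n) \sum_(s < n)
    ((q == r) && (p == s))%:R * (if P p q then z * F r s else 0)).
  rewrite -big_split; apply: eq_bigr => r _; rewrite -big_split /=.
  apply: eq_bigr => s _; rewrite !mulrDl.
  case: (p == q); case: (p == r); case: (q == s); case: (P p q);
    case: (q == r); case: (p == s);
    rewrite /= ?(mulr0, mulr1, mul0r, mul1r, addr0, add0r) //.
have D a b (G : 'I_n -> 'I_n -> A) :
    \sum_(r < n) \sum_(s < n) ((a == r) && (b == s))%:R * G r s = G a b.
  rewrite (bigD1 a) //= [X in _ + X]big1 ?addr0.
    rewrite (bigD1 b) //= big1 ?addr0 ?eqxx ?mul1r // => s sb.
    by rewrite [b == s]eq_sym (negPf sb) mul0r.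
  by move=> r ra; rewrite big1 // => s _; rewrite [a == r]eq_sym (negPf ra) mul0r.
by rewrite !D.
Qed.

Lemma sum_diag_coefr (x y z : A) (P : rel 'I_n) (F : 'I_n -> 'I_n -> A) r s :
  \sum_(p < n) \sum_(q < n)
    F p q * (x * ((p == q) && (p == r) && (q == s))%:R
     + y * ((p != q) && (p == r) && (q == s))%:R
     + z * (P p q && (p == s) && (q == r))%:R)
  = F r s * (if r == s then x else y) + (if P s r then F s r * z else 0).
Proof.
transitivity (\sum_(p < n) \sum_(q < n)
    (F p q * (if r == s then x else y)) * ((r == p) && (s == q))%:R
   + \sum_(p < n) \sum_(q < n)
    (if P s r then F p q * z else 0) * ((s == p) && (r == q))%:R).
  rewrite -big_split; apply: eq_bigr => p _; rewrite -big_split /=.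
  apply: eq_bigr => q _; rewrite !mulrDr [r == p]eq_sym [s == q]eq_sym
     [s == p]eq_sym [r == q]eq_sym.
  have -> : (p == q) && (p == r) && (q == s) = (r == s) && (p == r) && (q == s).
    by case: (eqVneq p r) => [->|]; case: (eqVneq q s) => [->|]; rewrite ?andbF.
  have -> : (p != q) && (p == r) && (q == s) = (r != s) && (p == r) && (q == s).
    by case: (eqVneq p r) => [->|]; case: (eqVneq q s) => [->|]; rewrite ?andbF.
  have -> : P p q && (p == s) && (q == r) = P s r && (p == s) && (q == r).
    by case: (eqVneq p s) => [->|]; case: (eqVneq q r) => [->|]; rewrite ?andbF.
  case: (r == s); case: (p == r); case: (q == s); case: (P s r);
    case: (q == r); case: (p == s);
    rewrite /= ?(mulr0, mulr1, mul0r, mul1r, addr0, add0r) //.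
have D a b (G : 'I_n -> 'I_n -> A) :
    \sum_(r < n) \sum_(s < n) G r s * ((a == r) && (b == s))%:R = G a b.
  rewrite (bigD1 a) //= [X in _ + X]big1 ?addr0.
    rewrite (bigD1 b) //= big1 ?addr0 ?eqxx ?mulr1 // => q sb.
    by rewrite [b == q]eq_sym (negPf sb) mulr0.
  by move=> p ra; rewrite big1 // => q _; rewrite [a == p]eq_sym (negPf ra) mulr0.
by rewrite !D.
Qed.

Lemma RentE v vi p q r s : Rent v vi p q r s =
    vi * ((p == q) && (p == r) && (q == s))%:R
     + 1 * ((p != q) && (p == r) && (q == s))%:R
     + (vi - v) * ((q < p)%N && (p == s) && (q == r))%:R.
Proof.
by rewrite /Rent sum_diag_EE sum_offdiag_EE (sum_swap_EE (fun i j => (j < i)%N)) mul1r.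
Qed.

Lemma RzentE v vi p q r s : Rzent v vi p q r s =
    v * ((p == q) && (p == r) && (q == s))%:R
     + 1 * ((p != q) && (p == r) && (q == s))%:R
     + (v - vi) * ((p < q)%N && (p == s) && (q == r))%:R.
Proof.
by rewrite /Rzent sum_diag_EE sum_offdiag_EE (sum_swap_EE (fun i j => (i < j)%N)) mul1r.
Qed.

Lemma Rwent_Rent v vi p q r s : Rwent v vi p q r s = - Rent v vi p q r s.
Proof. by rewrite /Rwent /Rent !opprD -!mulNr opprB. Qed.

End RMatrixEntries.

(** * Finite and loop relations as statements about defects *)

Section LoopRelations.
Variables (n : nat) (A : pzRingType).
Implicit Types (v vi : A) (i j k l : 'I_n) (X Y : 'I_n -> 'I_n -> A).
Implicit Types (S : 'I_n -> 'I_n -> 'I_n -> 'I_n -> A).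

(** Kept as a difference because it is then linear in [X] and in [Y]: signs and missing coefficients
    of a series pass through it. *)
Definition defect S X Y i k j l : A :=
  \sum_(a < n) \sum_(b < n) S i k a b * (X a j * Y b l)
  - \sum_(a < n) \sum_(b < n) (Y k b * X i a) * S a b j l.

Lemma defect_ext S X X' Y Y' i k j l :
  X =2 X' -> Y =2 Y' -> defect S X Y i k j l = defect S X' Y' i k j l.
Proof.
by move=> EX EY; congr (_ - _); apply: eq_bigr => a _; apply: eq_bigr => b _;
  rewrite EX EY.
Qed.

Lemma defect0l S Y i k j l : defect S (fun _ _ => 0) Y i k j l = 0.
Proof.
by rewrite /defect !big1 ?subr0 // => a _; rewrite big1 // => b _;
  rewrite /= ?(mul0r, mulr0).
Qed.

Lemma defect0r S X i k j l : defect S X (fun _ _ => 0) i k j l = 0.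
Proof.
by rewrite /defect !big1 ?subr0 // => a _; rewrite big1 // => b _;
  rewrite /= ?(mul0r, mulr0).
Qed.

Lemma defectNl S X Y i k j l :
  defect S (fun a b => - X a b) Y i k j l = - defect S X Y i k j l.
Proof.
rewrite /defect opprD; congr (_ + _); last congr (- _); rewrite -sumrN.
  by apply: eq_bigr => a _; rewrite -sumrN; apply: eq_bigr => b _;
    rewrite mulNr mulrN.
by apply: eq_bigr => a _; rewrite -sumrN; apply: eq_bigr => b _;
  rewrite mulrN mulNr.
Qed.

Lemma defectNr S X Y i k j l :
  defect S X (fun a b => - Y a b) i k j l = - defect S X Y i k j l.
Proof.
rewrite /defect opprD; congr (_ + _); last congr (- _); rewrite -sumrN.
  by apply: eq_bigr => a _; rewrite -sumrN; apply: eq_bigr => b _;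
    rewrite !mulrN.
by apply: eq_bigr => a _; rewrite -sumrN; apply: eq_bigr => b _;
  rewrite !mulNr.
Qed.

Lemma RTT_rel_defect v vi X Y :
  RTT_rel v vi X Y <-> forall i k j l, defect (Rent v vi) X Y i k j l = 0.
Proof.
split=> H i k j l; first by rewrite /defect H subrr.
by apply/eqP; rewrite -subr_eq0; apply/eqP/H.
Qed.

(** Because [R_w = - R], the coefficient of [z^a w^b] compares an [R_z] defect with an [R] defect at
    shifted indices. *)
Lemma RTTtrig_rel_defect v vi (X Y : 'I_n -> 'I_n -> int -> A) :
  RTTtrig_rel v vi X Y <->
  forall a b i k j l,
    defect (Rzent v vi) (fun p q => X p q (a - 1)) (fun p q => Y p q b) i k j l
    = defect (Rent v vi) (fun p q => X p q a) (fun p q => Y p q (b - 1)) i k j l.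
Proof.
have EL a b i k j l : \sum_(p < n) \sum_(q < n)
       (Rzent v vi i k p q * (X p j (a - 1) * Y q l b)
        + Rwent v vi i k p q * (X p j a * Y q l (b - 1)))
   = \sum_(p < n) \sum_(q < n) Rzent v vi i k p q * (X p j (a - 1) * Y q l b)
   - \sum_(p < n) \sum_(q < n) Rent v vi i k p q * (X p j a * Y q l (b - 1)).
  rewrite -sumrN -big_split; apply: eq_bigr => p _.
  rewrite -sumrN -big_split; apply: eq_bigr => q _ /=.
  by rewrite Rwent_Rent mulNr.
have ER a b i k j l : \sum_(p < n) \sum_(q < n)
       ((Y k q b * X i p (a - 1)) * Rzent v vi p q j l
        + (Y k q (b - 1) * X i p a) * Rwent v vi p q j l)
   = \sum_(p < n) \sum_(q < n) (Y k q b * X i p (a - 1)) * Rzent v vi p q j l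
   - \sum_(p < n) \sum_(q < n) (Y k q (b - 1) * X i p a) * Rent v vi p q j l.
  rewrite -sumrN -big_split; apply: eq_bigr => p _.
  rewrite -sumrN -big_split; apply: eq_bigr => q _ /=.
  by rewrite Rwent_Rent mulrN.
have K (a b c d : A) : a - b = c - d -> a - c = b - d.
  move=> E; have -> : a = c - d + b by rewrite -E subrK.
  by rewrite addrAC [c - d]addrC addrK addrC.
split=> H a b i k j l; have := H a b i k j l.
  by rewrite EL ER => /K.
by rewrite EL ER => /K.
Qed.

Lemma defect_RentE v vi X Y i k j l : defect (Rent v vi) X Y i k j l =
  ((if i == k then vi else 1) * (X i j * Y k l)
    + (if (k < i)%N then (vi - v) * (X k j * Y i l) else 0)) -
  ((Y k l * X i j) * (if j == l then vi else 1)
    + (if (j < l)%N then (Y k j * X i l) * (vi - v) else 0)).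
Proof.
rewrite /defect; congr (_ - _).
  under eq_bigr => a _ do under eq_bigr => b _ do rewrite RentE.
  exact: (sum_diag_coef _ _ _ (fun p q => (q < p)%N) (fun a b => X a j * Y b l)).
under eq_bigr => a _ do under eq_bigr => b _ do rewrite RentE.
exact: (sum_diag_coefr _ _ _ (fun p q => (q < p)%N) (fun a b => Y k b * X i a)).
Qed.

Lemma RTT_relE v vi X Y : RTT_rel v vi X Y <->
  forall i k j l,
    (if i == k then vi else 1) * (X i j * Y k l)
    + (if (k < i)%N then (vi - v) * (X k j * Y i l) else 0)
    = (Y k l * X i j) * (if j == l then vi else 1)
    + (if (j < l)%N then (Y k j * X i l) * (vi - v) else 0).
Proof.
split=> [/RTT_rel_defect H i k j l|H].
  by apply/eqP; rewrite -subr_eq0 -defect_RentE H.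
by apply/RTT_rel_defect => i k j l; rewrite defect_RentE H subrr.
Qed.

Lemma defect_RzentE v vi X Y i k j l : defect (Rzent v vi) X Y i k j l =
  ((if i == k then v else 1) * (X i j * Y k l)
    + (if (i < k)%N then (v - vi) * (X k j * Y i l) else 0)) -
  ((Y k l * X i j) * (if j == l then v else 1)
    + (if (l < j)%N then (Y k j * X i l) * (v - vi) else 0)).
Proof.
rewrite /defect; congr (_ - _).
  under eq_bigr => a _ do under eq_bigr => b _ do rewrite RzentE.
  exact: (sum_diag_coef _ _ _ (fun p q => (p < q)%N) (fun a b => X a j * Y b l)).
under eq_bigr => a _ do under eq_bigr => b _ do rewrite RzentE.
exact: (sum_diag_coefr _ _ _ (fun p q => (p < q)%N) (fun a b => Y k b * X i a)).
Qed.

(* [R_trig(z,w) = (z - w) R + (v - v^-1) z P], where [P] is the flip. *)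
Lemma defect_Rzent v vi X Y i k j l :
  defect (Rzent v vi) X Y i k j l
  = defect (Rent v vi) X Y i k j l
    + ((v - vi) * (X k j * Y i l) - (Y k j * X i l) * (v - vi)).
Proof.
rewrite defect_RzentE defect_RentE.
rewrite [RHS]addrACA -opprD; congr (_ - _).
  rewrite -(inj_eq val_inj) /=; case: (ltngtP i k) => [ik|ik|/val_inj ->] /=.
  - by rewrite addr0.
  - by rewrite !addr0 -addrA -mulrDl -(opprB v) addNr mul0r addr0.
  - by rewrite !addr0 -mulrDl addrC subrK.
rewrite -(inj_eq val_inj) /=; case: (ltngtP j l) => [ik|ik|/val_inj ->] /=.
- by rewrite !addr0 -addrA -mulrDr -(opprB v) addNr mulr0 addr0.
- by rewrite addr0.
- by rewrite !addr0 -mulrDr addrC subrK.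
Qed.

(** At [w^1] the [R_z] side involves [Y[1]], which is zero for [T^+] since it has no positive
    powers; the [R] side keeps an arbitrary coefficient of [X]. *)
Lemma RTTtrig_rel_w1 v vi (X Y : 'I_n -> 'I_n -> int -> A) :
  RTTtrig_rel v vi X Y -> (forall k l, Y k l 1 = 0) ->
  forall a, RTT_rel v vi (fun i j => X i j a) (fun i j => Y i j 0).
Proof.
move=> /RTTtrig_rel_defect H Y1 a; apply/RTT_rel_defect => i k j l.
have /esym := H a 1 i k j l; rewrite subrr => ->.
by rewrite (defect_ext _ _ _ _ _ (fun _ _ => erefl) Y1) defect0r.
Qed.

Lemma RTTtrig_rel_z0 v vi (X Y : 'I_n -> 'I_n -> int -> A) :
  RTTtrig_rel v vi X Y -> (forall k l, X k l (-1) = 0) ->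
  forall b, RTT_rel v vi (fun i j => X i j 0) (fun i j => Y i j b).
Proof.
move=> /RTTtrig_rel_defect H X1 b; apply/RTT_rel_defect => i k j l.
have /esym := H 0 (b + 1) i k j l; rewrite addrK sub0r => ->.
by rewrite (defect_ext _ _ _ _ _ X1 (fun _ _ => erefl)) defect0l.
Qed.

(* The series [T^+ - T^- z^-1], by its coefficients. *)
Definition ev_series (tp tm : 'I_n -> 'I_n -> A) i j (k : int) : A :=
  match k with Posz 0 => tp i j | Negz 0 => - tm i j | _ => 0 end.

(** All defects vanish separately except at [z^0 w^0], where the [R_z] defect of [(tm, tp)] has to
    match the [R] defect of [(tp, tm)]. This is [zmp], obtained by trading both for flip terms. *)
Lemma RTTtrig_rel_ev_series v vi (tp tm : 'I_n -> 'I_n -> A) :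
  (forall a, (v - vi) * a = a * (v - vi)) ->
  RTT_rel v vi tp tp -> RTT_rel v vi tm tm -> RTT_rel v vi tm tp ->
  (forall i k j l, defect (Rzent v vi) tp tm i k j l = 0) ->
  RTTtrig_rel v vi (ev_series tp tm) (ev_series tp tm).
Proof.
move=> vC /RTT_rel_defect pp /RTT_rel_defect mm /RTT_rel_defect mp zpm.
have zpp i k j l : defect (Rzent v vi) tp tp i k j l = 0.
  by rewrite defect_Rzent pp vC subrr add0r.
have zmm i k j l : defect (Rzent v vi) tm tm i k j l = 0.
  by rewrite defect_Rzent mm vC subrr add0r.
have zmp i k j l : defect (Rzent v vi) tm tp i k j l = defect (Rent v vi) tp tm i k j l.
  rewrite defect_Rzent mp add0r; have := zpm i k j l; rewrite defect_Rzent => /eqP.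
  by rewrite addr_eq0 => /eqP ->; rewrite opprB -!vC.
apply/RTTtrig_rel_defect => a b i k j l.
by case: a => [[|[|a]]|[|a]]; case: b => [[|[|b]]|[|b]];
  rewrite /= ?(defectNl, defectNr, defect0r, defect0l, zpp, zmm, zmp, zpm, pp, mm, mp,
    oppr0, opprK).
Qed.
End LoopRelations.

(** * The kernel is contained in the ideal *)

(** As [o] is the least index, any other index produces a flip term, in which the unknown entry is
    multiplied by invertible elements only. *)
Lemma RTT_rel_rigid (n : nat) (A : pzRingType) (v vi w : A) (o : 'I_n)
    (tp tm D : 'I_n -> 'I_n -> A) (ip im : A) :
  o = 0%N :> nat -> w * (vi - v) = 1 -> (vi - v) * w = 1 ->
  ip * tp o o = 1 -> im * tm o o = 1 ->
  RTT_rel v vi D tp -> RTT_rel v vi tm D -> D o o = 0 ->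
  forall i j, D i j = 0.
Proof.
move=> o0 wv vw ipp imm /RTT_relE Dp /RTT_relE mD Doo.
have gt0 (l : 'I_n) : l != o -> (o < l)%N.
  by rewrite -(inj_eq val_inj) /= o0 lt0n.
have Do l : D o l = 0.
  have [->//|lo] := eqVneq l o.
  (* With [D o o = 0] only the flip term [tp o o * D o l * (vi - v)] is left, so the first row is
     zero. *)
  have := Dp o o o l; rewrite Doo !(mul0r, mulr0) ltnn (gt0 _ lo) !add0r.
  move=> /esym/(congr1 (fun x => ip * x * w)).
  by rewrite -!mulrA vw mulr1 mulrA ipp mul1r mul0r mulr0.
move=> i j; have [->//|io] := eqVneq i o.
(* The first row being zero, this entry isolates [(vi - v) * (tm o o * D i j)]. *)
have := mD i o o j; rewrite Do Doo (gt0 _ io) !(mul0r, mulr0) if_same !add0r.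
move=> /(congr1 (fun x => im * (w * x))).
by rewrite !mulrA -[im * w * _]mulrA wv mulr1 imm mul1r mulr0.
Qed.

Lemma vK_neq0 : vK != 0.
Proof. by rewrite /vK -[0]/(tofrac 0) tofrac_eq polyX_eq0. Qed.

Lemma vK_subV_neq0 : vK^-1 - vK != 0.
Proof.
rewrite subr_eq0; apply/negP => /eqP/(congr1 (fun x => vK * x)).
rewrite divff ?vK_neq0 // /vK -tofracM => /eqP.
rewrite -[1]/(tofrac 1) tofrac_eq => /eqP/(congr1 (fun p : {poly _} => p`_0)).
by rewrite -expr2 coefXn coefC => /eqP; rewrite oner_eq0.
Qed.

(** An alias on which a [C]-algebra structure can be declared beside the [C(v)]-structure of [B];
    the kernel condition is stated over [C]. *)
Definition restr (B : algType Cv) : Type := B.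

Section Restriction.
Variable B : algType Cv.
HB.instance Definition _ := GRing.NzRing.on (restr B).
Definition restr_scale (c : CC) (b : restr B) : restr B :=
  (tofrac c%:P : Cv) *: (b : B).
Lemma restr_scaleA a b (x : restr B) :
  restr_scale a (restr_scale b x) = restr_scale (a * b) x.
Proof. by rewrite /restr_scale scalerA -tofracM -polyCM. Qed.
Lemma restr_scale1 : left_id 1 restr_scale.
Proof. by move=> x; rewrite /restr_scale tofrac1 scale1r. Qed.
Lemma restr_scaleDr : right_distributive restr_scale +%R.
Proof. by move=> a x y; rewrite /restr_scale scalerDr. Qed.
Lemma restr_scaleDl (x : restr B) : {morph restr_scale^~ x : a b / a + b}.
Proof. by move=> a b; rewrite /restr_scale polyCD tofracD scalerDl. Qed.
HB.instance Definition _ := GRing.Zmodule_isLmodule.Build CC (restr B)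
  restr_scaleA restr_scale1 restr_scaleDr restr_scaleDl.
Lemma restr_scaleAl (a : CC) (x y : restr B) : a *: (x * y) = a *: x * y.
Proof. exact: (scalerAl (tofrac a%:P : Cv) (x : B) (y : B)). Qed.
HB.instance Definition _ := GRing.Lmodule_isLalgebra.Build CC (restr B) restr_scaleAl.
Lemma restr_scaleAr (a : CC) (x y : restr B) : a *: (x * y) = x * (a *: y).
Proof. exact: (scalerAr (tofrac a%:P : Cv) (x : B) (y : B)). Qed.
HB.instance Definition _ := GRing.Lalgebra_isAlgebra.Build CC (restr B) restr_scaleAr.
End Restriction.

Lemma teval_ext (X : Type) (A : pzRingType) (cst cst' : CC -> A) (v vi : A)
    (g h : X -> A) (t : term X) :
  cst =1 cst' -> g =1 h -> teval cst v vi g t = teval cst' v vi h t.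
Proof.
by move=> cc gh; elim: t => [x|c| | |t IHt u IHu|t IHt u IHu] //=; rewrite IHt IHu.
Qed.

Lemma in_ker_ev_in_ideal_I (n : nat) (hn : (0 < n)%N) (x : term (lgen n)) :
  in_ker_ev x -> in_ideal_I hn x.
Proof.
move=> kx o B tp tm v vi [inv tri pp mm mp] ge2 t1 m1.
have vvi : v * vi = 1 by rewrite /v /vi -scalerAl mul1r scalerA divff ?vK_neq0 ?scale1r.
have viv : vi * v = 1 by rewrite /v /vi -scalerAl mul1r scalerA mulVf ?vK_neq0 ?scale1r.
have [wv vw] : ((vK^-1 - vK)^-1)%:A * (vi - v) = 1 /\ (vi - v) * ((vK^-1 - vK)^-1)%:A = 1.
  rewrite /v /vi -scalerBl -!scalerAl !mul1r !scalerA mulVf ?divff ?scale1r //;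
  exact: vK_subV_neq0.
have vC (a : B) : v * a = a * v by rewrite /v mulr_algl mulr_algr.
have p1 k l : Defs.coefp tp k l 1 = 0 by [].
have mn1 k l : coefm tm k l (-1) = 0 by [].
have Pp a := RTTtrig_rel_w1 pp p1 a.
have Mp a := RTTtrig_rel_w1 mp p1 a.
have mP a := RTTtrig_rel_z0 mp mn1 a.
have mM a := RTTtrig_rel_z0 mm mn1 a.
have pcoef i j s : Defs.coefp tp i j (- s%:Z) = tp i j s by rewrite /Defs.coefp opprK.
pose tp0 i j := tp i j 0%N; pose tm0 i j := tm i j 0%N.
have ifD (b : bool) (y z : B) :
    (if b then y + z else 0) = (if b then y else 0) + (if b then z else 0).
  by case: b; rewrite ?addr0.
have rel_add X Y Z : RTT_rel v vi X Z -> RTT_rel v vi Y Z ->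
    RTT_rel v vi (fun i j => X i j + Y i j : B) Z.
  move=> /RTT_relE HX /RTT_relE HY; apply/RTT_relE => i k j l.
  move: (HX i k j l) (HY i k j l); move: (vi - v) => d EX EY.
  by rewrite !(mulrDl, mulrDr) !ifD addrACA EX EY addrACA.
have rel_add' X Y Z : RTT_rel v vi Z X -> RTT_rel v vi Z Y ->
    RTT_rel v vi Z (fun i j => X i j + Y i j : B).
  move=> /RTT_relE HX /RTT_relE HY; apply/RTT_relE => i k j l.
  move: (HX i k j l) (HY i k j l); move: (vi - v) => d EX EY.
  by rewrite !(mulrDl, mulrDr) !ifD addrACA EX EY addrACA.
have [inv1 inv2] := inv o.
have rigid D := @RTT_rel_rigid n B v vi _ o tp0 tm0 D _ _ erefl wv vw inv2 inv1.
(* Both summands satisfy the two relations that [rigid] asks for: [tp[1]] is read off [T^+] at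
   [z^-1], and [tm[0]] off [T^-] at [z^0]. *)
have P1 i j : tp i j 1%N + tm i j 0%N = 0.
  apply: (rigid (fun i j => tp i j 1%N + tm i j 0%N)) => //.
    apply: rel_add; [exact: (Pp (-1))|exact: (Mp 0)].
  apply: rel_add'; [exact: (mP (-1))|exact: (mM 0)].
have M1 i j : tm i j 1%N + tp i j 0%N = 0.
  apply: (rigid (fun i j => tm i j 1%N + tp i j 0%N)) => //.
    apply: rel_add; [exact: (Mp 1)|exact: (Pp 0)].
  apply: rel_add'; [exact: (mM 1)|exact: (mP 0)].
(* [Negz s.+1] is [-(s + 2)], the power of [z] at which [T^+] carries [tp[s + 2]]. *)
have P2 s i j : tp i j s.+2 = 0.
  apply: (rigid (fun i j => tp i j s.+2)) => //.
  - exact: (Pp (Negz s.+1)).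
  - exact: (mP (Negz s.+1)).
  - by case: (ge2 s.+2).
have M2 s i j : tm i j s.+2 = 0.
  apply: (rigid (fun i j => tm i j s.+2)) => //.
  - exact: (Mp s.+2).
  - exact: (mM s.+2).
  - by case: (ge2 s.+2).
rewrite (@teval_ext _ _ _ _ _ _ _ (ev_assign tp0 tm0) _ (fun=> erefl)).
  apply: (kx (restr B) v vi tp0 tm0 vC) => //.
  split=> //; [exact: (Pp 0)|exact: (mM 0)|exact: (Mp 0)].
case=> [[[[] i] j] [|[|s]]] //=.
  by apply/eqP; rewrite -addr_eq0; apply/eqP.
by apply/eqP; rewrite -addr_eq0; apply/eqP.
Qed.

(** * Representations on tensor powers *)

Section VectorScalars.
Variables (K : fieldType) (v : K).
Hypothesis v0 : v != 0.
Variables (D : K) (E : nat -> nat -> K).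

(** In the vector representation [t^+_ij] is [delta_ij + vec_coefp i j e_ij]; thus [t^+_ii]
    multiplies the [i]-th basis vector by [v^-1] and fixes the others. [D] and [E] stand for one
    matrix entry of the identity and of the units, which turns each relation into scalar identities
    settled by comparing indices. *)
Definition vec_coefp (i j : nat) : K :=
  if i == j then v^-1 - 1 else if (i < j)%N then v^-1 - v else 0.
Definition vec_coefm (i j : nat) : K :=
  if i == j then v - 1 else if (j < i)%N then v - v^-1 else 0.

(* [(delta_ij + c_ij e_ij) (delta_kl + c'_kl e_kl)] for matrix units [e]. *)
Definition vec_prod (c c' : nat -> nat -> K) (i j k l : nat) : K :=
  ((i == j) && (k == l))%:R * D + (k == l)%:R * (c i j * E i j)
  + (i == j)%:R * (c' k l * E k l) + (j == k)%:R * (c i j * c' k l * E i l).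

Ltac vec_case a b :=
  case: (ltngtP a b) => [?|?|?]; try (exfalso; lia).
Ltac vec_tac i k j l :=
  rewrite /vec_prod /vec_coefp /vec_coefm;
  vec_case i k; vec_case j l; vec_case i j; vec_case k l; vec_case i l; vec_case j k;
  subst; rewrite ?(eqxx, ltnn) /= ?(mul0r, mulr0, mul1r, addr0, add0r); try by field.

Lemma vec_prodp (i k j l : nat) :
  (if i == k then v^-1 else 1) * vec_prod vec_coefp vec_coefp i j k l
    + (if (k < i)%N then (v^-1 - v) * vec_prod vec_coefp vec_coefp k j i l else 0)
  = (if j == l then v^-1 else 1) * vec_prod vec_coefp vec_coefp k l i j
    + (if (j < l)%N then (v^-1 - v) * vec_prod vec_coefp vec_coefp k j i l else 0).
Proof. by vec_tac i k j l. Qed.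

Lemma vec_prodm (i j k l : nat) :
  (if i == k then v^-1 else 1) * vec_prod vec_coefm vec_coefm i j k l
    + (if (k < i)%N then (v^-1 - v) * vec_prod vec_coefm vec_coefm k j i l else 0)
  = (if j == l then v^-1 else 1) * vec_prod vec_coefm vec_coefm k l i j
    + (if (j < l)%N then (v^-1 - v) * vec_prod vec_coefm vec_coefm k j i l else 0).
Proof. by vec_tac i k j l. Qed.

Lemma vec_prodmp (i j k l : nat) :
  (if i == k then v^-1 else 1) * vec_prod vec_coefm vec_coefp i j k l
    + (if (k < i)%N then (v^-1 - v) * vec_prod vec_coefm vec_coefp k j i l else 0)
  = (if j == l then v^-1 else 1) * vec_prod vec_coefp vec_coefm k l i j
    + (if (j < l)%N then (v^-1 - v) * vec_prod vec_coefp vec_coefm k j i l else 0).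
Proof. by vec_tac i k j l. Qed.

Lemma vec_prodpm (i j k l : nat) :
  (if i == k then v else 1) * vec_prod vec_coefp vec_coefm i j k l
    + (if (i < k)%N then (v - v^-1) * vec_prod vec_coefp vec_coefm k j i l else 0)
  = (if j == l then v else 1) * vec_prod vec_coefm vec_coefp k l i j
    + (if (l < j)%N then (v - v^-1) * vec_prod vec_coefm vec_coefp k j i l else 0).
Proof. by vec_tac i k j l. Qed.
End VectorScalars.

(** * The coproduct and its iteration on matrices *)

Section Coproduct.
Variables (n : nat) (A : pzRingType).
Implicit Types (X Y : 'I_n -> 'I_n -> A) (S : 'I_n -> 'I_n -> 'I_n -> 'I_n -> A).

Definition coprod X X' (i j : 'I_n) := \sum_(p < n) X i p * X' p j.

Lemma coprod_mul X X' Y Y' a b j l :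
  (forall i j k l, X' i j * Y k l = Y k l * X' i j) ->
  coprod X X' a j * coprod Y Y' b l
  = \sum_(x : 'I_n * 'I_n) (X a x.1 * Y b x.2) * (X' x.1 j * Y' x.2 l).
Proof.
move=> comm; rewrite /coprod big_distrlr pair_bigA; apply: eq_bigr => x _ /=.
by rewrite -!mulrA [X' _ _ * (Y _ _ * _)]mulrA comm !mulrA.
Qed.

(** From [R T_1 T'_1 T_2 T'_2 = R T_1 T_2 T'_1 T'_2]: entries of the two families commute, so [R]
    moves first through the unprimed pair and then through the primed one. *)
Lemma defect_coprod S X X' Y Y' :
  (forall i j k l, X' i j * Y k l = Y k l * X' i j) ->
  (forall i j k l, Y' i j * X k l = X k l * Y' i j) ->
  (forall i k j l, defect S X Y i k j l = 0) ->
  (forall i k j l, defect S X' Y' i k j l = 0) ->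
  forall i k j l, defect S (coprod X X') (coprod Y Y') i k j l = 0.
Proof.
move=> cXY cYX; rewrite /defect => D D' i k j l.
have E a b c d : \sum_(x : 'I_n * 'I_n) S a b x.1 x.2 * (X x.1 c * Y x.2 d)
    = \sum_(x : 'I_n * 'I_n) (Y b x.2 * X a x.1) * S x.1 x.2 c d.
  have /eqP := D a b c d; rewrite subr_eq0 => /eqP.
  by rewrite !pair_bigA.
have E' a b c d : \sum_(x : 'I_n * 'I_n) S a b x.1 x.2 * (X' x.1 c * Y' x.2 d)
    = \sum_(x : 'I_n * 'I_n) (Y' b x.2 * X' a x.1) * S x.1 x.2 c d.
  have /eqP := D' a b c d; rewrite subr_eq0 => /eqP.
  by rewrite !pair_bigA.
apply/eqP; rewrite subr_eq0 !pair_bigA /=; apply/eqP.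
transitivity (\sum_(y : 'I_n * 'I_n) \sum_(x : 'I_n * 'I_n)
    (S i k x.1 x.2 * (X x.1 y.1 * Y x.2 y.2)) * (X' y.1 j * Y' y.2 l)).
  rewrite exchange_big; apply: eq_bigr => x _.
  by rewrite coprod_mul // mulr_sumr; apply: eq_bigr => y _; rewrite !mulrA.
transitivity (\sum_(x : 'I_n * 'I_n) \sum_(y : 'I_n * 'I_n)
    (Y k x.2 * X i x.1) * (S x.1 x.2 y.1 y.2 * (X' y.1 j * Y' y.2 l))).
  rewrite [RHS]exchange_big; apply: eq_bigr => y _ /=.
  by rewrite -mulr_suml E mulr_suml; apply: eq_bigr => x _; rewrite !mulrA.
transitivity (\sum_(x : 'I_n * 'I_n) \sum_(y : 'I_n * 'I_n)
    (Y k x.2 * X i x.1) * ((Y' x.2 y.2 * X' x.1 y.1) * S y.1 y.2 j l)).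
  by apply: eq_bigr => x _; rewrite -!mulr_sumr E'.
rewrite exchange_big; apply: eq_bigr => y _ /=.
rewrite coprod_mul // mulr_suml -(pair_bigA _ (fun a b =>
  Y k b * X i a * (Y' b y.2 * X' a y.1 * S y.1 y.2 j l))) exchange_big.
by rewrite pair_bigA; apply: eq_bigr => x _ /=; rewrite !mulrA.
Qed.
End Coproduct.

Section TensorProduct.
Variable R : comPzRingType.

Lemma tensmxDl m n p q (A B : 'M[R]_(m, n)) (C : 'M_(p, q)) :
  (A + B) *t C = A *t C + B *t C.
Proof. by apply/matrixP=> i j; rewrite !mxE mulrDl. Qed.
Lemma tensmxDr m n p q (A : 'M[R]_(m, n)) (B C : 'M_(p, q)) :
  A *t (B + C) = A *t B + A *t C.
Proof. by apply/matrixP=> i j; rewrite !mxE mulrDr. Qed.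
Lemma tensmxZl m n p q a (A : 'M[R]_(m, n)) (B : 'M_(p, q)) :
  (a *: A) *t B = a *: (A *t B).
Proof. by apply/matrixP=> i j; rewrite !mxE mulrA. Qed.
Lemma tensmxZr m n p q a (A : 'M[R]_(m, n)) (B : 'M_(p, q)) :
  A *t (a *: B) = a *: (A *t B).
Proof. by apply/matrixP=> i j; rewrite !mxE mulrCA. Qed.
Lemma tensmx11 m n : (1%:M : 'M[R]_m) *t (1%:M : 'M[R]_n) = 1%:M.
Proof.
apply/matrixP=> i j; case: (mxtens_indexP i) => i0 i1; case: (mxtens_indexP j) => j0 j1.
rewrite tensmxE !mxE (can_eq (@mxtens_indexK m n)) xpair_eqE.
by rewrite -natrM mulnb.
Qed.

Variables (m p : nat).
Definition tens1l (A : 'M[R]_m) : 'M[R]_(m * p) := A *t 1%:M.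
Definition tens1r (A : 'M[R]_p) : 'M[R]_(m * p) := 1%:M *t A.

Lemma tens1l_zmod : zmod_morphism tens1l.
Proof. by move=> A B; rewrite /tens1l tensmxDl -scaleN1r tensmxZl scaleN1r. Qed.
Lemma tens1l_monoid : monoid_morphism tens1l.
Proof. by split=> [|A B]; rewrite /tens1l ?tensmx11 // [RHS]tensmx_mul mulmx1. Qed.
Lemma tens1r_zmod : zmod_morphism tens1r.
Proof. by move=> A B; rewrite /tens1r tensmxDr -scaleN1r tensmxZr scaleN1r. Qed.
Lemma tens1r_monoid : monoid_morphism tens1r.
Proof. by split=> [|A B]; rewrite /tens1r ?tensmx11 // [RHS]tensmx_mul mulmx1. Qed.
HB.instance Definition _ := GRing.isZmodMorphism.Build _ _ tens1l tens1l_zmod.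
HB.instance Definition _ := GRing.isMonoidMorphism.Build _ _ tens1l tens1l_monoid.
HB.instance Definition _ := GRing.isZmodMorphism.Build _ _ tens1r tens1r_zmod.
HB.instance Definition _ := GRing.isMonoidMorphism.Build _ _ tens1r tens1r_monoid.

Lemma tens1lr A B : tens1l A * tens1r B = A *t B.
Proof. by rewrite [LHS]tensmx_mul mulmx1 mul1mx. Qed.
Lemma tens1rl A B : tens1r B * tens1l A = A *t B.
Proof. by rewrite [LHS]tensmx_mul mulmx1 mul1mx. Qed.
End TensorProduct.

Lemma defect_morph n (A B : pzRingType) (f : {rmorphism A -> B}) v vi X Y
    (i k j l : 'I_n) :
  (defect (Rent v vi) X Y i k j l = 0 ->
   defect (Rent (f v) (f vi)) (fun a b => f (X a b)) (fun a b => f (Y a b)) i k j l = 0)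
  /\ (defect (Rzent v vi) X Y i k j l = 0 ->
   defect (Rzent (f v) (f vi)) (fun a b => f (X a b)) (fun a b => f (Y a b)) i k j l = 0).
Proof.
split=> /(congr1 f); rewrite rmorph0 => <-.
  rewrite !defect_RentE -rmorphB -(rmorph1 f) -(rmorph0 f) -!(fun_if f).
  by rewrite -!rmorphM /= -!(fun_if f) -!rmorphD -rmorphB.
rewrite !defect_RzentE -rmorphB -(rmorph1 f) -(rmorph0 f) -!(fun_if f).
by rewrite -!rmorphM /= -!(fun_if f) -!rmorphD -rmorphB.
Qed.

(** [R_z] is the inverse of [R] with its tensor factors exchanged, so the last clause is the mixed
    relation read with [T^+] in the first factor. The loop relations are derived from it in this
    form. *)
Definition rtt_pair (n : nat) (A : pzRingType) (v vi : A)
    (tp tm : 'I_n -> 'I_n -> A) : Prop :=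
  [/\ forall i, tp i i * tm i i = 1 /\ tm i i * tp i i = 1,
      forall i j : 'I_n, (j < i)%N -> tp i j = 0 /\ tm j i = 0,
      forall i k j l, defect (Rent v vi) tp tp i k j l = 0 /\
        defect (Rent v vi) tm tm i k j l = 0,
      forall i k j l, defect (Rent v vi) tm tp i k j l = 0 &
      forall i k j l, defect (Rzent v vi) tp tm i k j l = 0].

Lemma rtt_pair_fin_rels n (A : pzRingType) (v vi : A) (tp tm : 'I_n -> 'I_n -> A) :
  rtt_pair v vi tp tm -> fin_rels v vi tp tm.
Proof.
case=> inv tri ppmm mp _; split=> //; apply/RTT_rel_defect => i k j l //;
  by case: (ppmm i k j l).
Qed.

Lemma rtt_pair_morph n (A B : pzRingType) (f : {rmorphism A -> B}) v vi
    (tp tm : 'I_n -> 'I_n -> A) : rtt_pair v vi tp tm ->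
  rtt_pair (f v) (f vi) (fun i j => f (tp i j)) (fun i j => f (tm i j)).
Proof.
case=> inv tri ppmm mp pm; split=> [i|i j ji|i k j l|i k j l|i k j l].
- by case: (inv i) => E F; rewrite -!rmorphM E F rmorph1.
- by case: (tri i j ji) => -> ->; rewrite rmorph0.
- by split; apply: (defect_morph f v vi _ _ i k j l).1; case: (ppmm i k j l).
- exact: (defect_morph f v vi _ _ i k j l).1 (mp i k j l).
- exact: (defect_morph f v vi _ _ i k j l).2 (pm i k j l).
Qed.

Lemma rtt_pair_coprod n (A : pzRingType) (v vi : A) (tp tm tp' tm' : 'I_n -> 'I_n -> A) :
  (forall i j k l, tp' i j * tp k l = tp k l * tp' i j) ->
  (forall i j k l, tp' i j * tm k l = tm k l * tp' i j) ->
  (forall i j k l, tm' i j * tp k l = tp k l * tm' i j) ->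
  (forall i j k l, tm' i j * tm k l = tm k l * tm' i j) ->
  rtt_pair v vi tp tm -> rtt_pair v vi tp' tm' ->
  rtt_pair v vi (coprod tp tp') (coprod tm tm').
Proof.
move=> cpp cpm cmp cmm [inv tri ppmm mp pm] [inv' tri' ppmm' mp' pm'].
have tri0p (i j : 'I_n) : (j < i)%N -> tp i j = 0 by move=> /tri[].
have tri0m (i j : 'I_n) : (i < j)%N -> tm i j = 0 by move=> /tri[].
have tri0p' (i j : 'I_n) : (j < i)%N -> tp' i j = 0 by move=> /tri'[].
have tri0m' (i j : 'I_n) : (i < j)%N -> tm' i j = 0 by move=> /tri'[].
have diagp i : coprod tp tp' i i = tp i i * tp' i i.
  rewrite /coprod (bigD1 i) //= big1 ?addr0 // => k.
  rewrite -(inj_eq val_inj) /= neq_ltn => /orP[ki|ik].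
    by rewrite tri0p // mul0r.
  by rewrite tri0p' // mulr0.
have diagm i : coprod tm tm' i i = tm i i * tm' i i.
  rewrite /coprod (bigD1 i) //= big1 ?addr0 // => k.
  rewrite -(inj_eq val_inj) /= neq_ltn => /orP[ki|ik].
    by rewrite tri0m' // mulr0.
  by rewrite tri0m // mul0r.
split=> [i|i j ji|i k j l|i k j l|i k j l].
- rewrite diagp diagm; have [E F] := inv i; have [E' F'] := inv' i; split.
    by rewrite -mulrA (mulrA (tp' i i)) cpm -mulrA E' mulr1 E.
  by rewrite -mulrA (mulrA (tm' i i)) cmp -mulrA F' mulr1 F.
- split; rewrite /coprod big1 // => k _.
    have [ik|ki] := ltnP k i; first by rewrite tri0p // mul0r.
    by rewrite tri0p' ?mulr0 // (leq_trans ji).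
  have [ik|ki] := ltnP j k; first by rewrite tri0m // mul0r.
  by rewrite tri0m' ?mulr0 // (leq_ltn_trans ki).
- by split; apply: defect_coprod => // i' k' j' l'; case: (ppmm i' k' j' l') (ppmm' i' k' j' l') => ? ? [].
- exact: defect_coprod.
- exact: defect_coprod.
Qed.

(** Indices are shifted by one: coordinate 0 is the extra basis vector, killed by all units, on
    which [t_ij] therefore acts as [delta_ij]. *)
Definition vec_unit n (R : pzRingType) (i j : nat) : 'M[R]_n.+1 :=
  \matrix_(a, b) ((val a == i.+1) && (val b == j.+1))%:R.

Lemma vec_unit_mul n (R : pzRingType) (i j k l : nat) : (j < n)%N ->
  vec_unit n R i j * vec_unit n R k l = (j == k)%:R *: vec_unit n R i l.
Proof.
move=> jn; apply/matrixP => a b; rewrite !mxE (bigD1 (Ordinal (jn : j.+1 < n.+1)%N)) //=.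
rewrite big1 ?addr0 => [|c cj].
  by rewrite !mxE /= eqxx andbT eqSS; case: (_ == _); case: (_ == _) => //=;
    rewrite ?(mulr0, mul0r, mul1r).
by rewrite !mxE -!val_eqE /= in cj *; rewrite (negPf cj) andbF mul0r.
Qed.

Section Tower.
Variables (R : comPzRingType) (n p : nat) (al be ga : nat -> R)
  (a : 'I_n -> 'I_n -> 'M[R]_p).

Fixpoint tower_dim (r : nat) : nat := if r is r'.+1 then (tower_dim r' * p)%N else 1%N.

(* With [al = be = ga = 1], [1 + tower] is the [r]-fold iterated coproduct of [1 + a]. *)
Fixpoint tower (r : nat) : 'I_n -> 'I_n -> 'M[R]_(tower_dim r) :=
  match r with
  | 0 => fun _ _ => 0
  | r'.+1 => fun i j => al r' *: (1%:M *t a i j) + be r' *: (tower r' i j *t 1%:M)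
       + ga r' *: \sum_k (tower r' i k *t a k j)
  end.
End Tower.

(** Generators are written as identity plus [W] because it is [W], not the generator, that is
    divisible by [v - 1]. *)
Definition id_plus (R : pzRingType) n m (W : 'I_n -> 'I_n -> 'M[R]_m) (i j : 'I_n) : 'M[R]_m :=
  (i == j)%:R%:M + W i j.

Lemma id_plus_tower (R : comPzRingType) n p (a : 'I_n -> 'I_n -> 'M[R]_p) r i j :
  id_plus (tower (fun=> 1) (fun=> 1) (fun=> 1) a r.+1) i j =
  \sum_k (id_plus (tower (fun=> 1) (fun=> 1) (fun=> 1) a r) i k *t id_plus a k j).
Proof.
rewrite /id_plus /= !scale1r; move: (tower _ _ _ a r) => W.
have D (V : lmodType R) (F : 'I_n -> V) x : \sum_k (x == k)%:R *: F k = F x.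
  rewrite (bigD1 x) //= eqxx scale1r big1 ?addr0 // => k kx.
  by rewrite eq_sym (negPf kx) scale0r.
under [RHS]eq_bigr => k _ do rewrite -![(_ == _)%:R%:M]scalemx1 tensmxDl !tensmxDr
  !(tensmxZl, tensmxZr) tensmx11.
rewrite !big_split /= !D.
rewrite -[(i == j)%:R%:M]scalemx1 !addrA; congr (_ + _ + _ + _).
all: rewrite (bigD1 j) //= eqxx scale1r big1 ?addr0 // => k kj.
all: by rewrite (negPf kj) scale0r.
Qed.

Lemma coprod_tens (R : comPzRingType) n m p (T : 'I_n -> 'I_n -> 'M[R]_m)
    (a : 'I_n -> 'I_n -> 'M[R]_p) i j :
  coprod (fun i j => tens1l p (T i j)) (fun i j => tens1r m (a i j)) i j
  = \sum_k T i k *t a k j.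
Proof. by apply: eq_bigr => k _; rewrite tens1lr. Qed.

Section MatrixDefect.
Variables (R : comPzRingType) (n m : nat) (v vi : R) (X Y : 'I_n -> 'I_n -> 'M[R]_m).

Lemma defect_Rent_mx i k j l :
  (forall a b, (if i == k then vi else 1) * (X i j * Y k l) a b
    + (if (k < i)%N then (vi - v) * (X k j * Y i l) a b else 0)
   = (if j == l then vi else 1) * (Y k l * X i j) a b
    + (if (j < l)%N then (vi - v) * (Y k j * X i l) a b else 0)) ->
  defect (Rent v%:M vi%:M) X Y i k j l = 0.
Proof.
move=> H; rewrite defect_RentE; apply/eqP; rewrite subr_eq0; apply/eqP.
rewrite -rmorphB; apply/matrixP => a b; have := H a b.
move: (X i j * Y k l) (X k j * Y i l) (Y k l * X i j) (Y k j * X i l) => P Q P' Q'.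
by do 4![case: ifP => _]; rewrite -?mulmxE ?(mul1mx, mulmx1, mul_scalar_mx, mul_mx_scalar,
  mul1r, mulr1, addr0) => E; rewrite ?mxE.
Qed.

Lemma defect_Rzent_mx i k j l :
  (forall a b, (if i == k then v else 1) * (X i j * Y k l) a b
    + (if (i < k)%N then (v - vi) * (X k j * Y i l) a b else 0)
   = (if j == l then v else 1) * (Y k l * X i j) a b
    + (if (l < j)%N then (v - vi) * (Y k j * X i l) a b else 0)) ->
  defect (Rzent v%:M vi%:M) X Y i k j l = 0.
Proof.
move=> H; rewrite defect_RzentE; apply/eqP; rewrite subr_eq0; apply/eqP.
rewrite -rmorphB; apply/matrixP => a b; have := H a b.
move: (X i j * Y k l) (X k j * Y i l) (Y k l * X i j) (Y k j * X i l) => P Q P' Q'.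
by do 4![case: ifP => _]; rewrite -?mulmxE ?(mul1mx, mulmx1, mul_scalar_mx, mul_mx_scalar,
  mul1r, mulr1, addr0) => E; rewrite ?mxE.
Qed.
End MatrixDefect.

Section VectorRepresentation.
Variables (n : nat) (K : fieldType) (v : K).
Hypothesis v0 : v != 0.

Definition vec_p (i j : 'I_n) : 'M[K]_n.+1 := vec_coefp v i j *: vec_unit n K i j.
Definition vec_m (i j : 'I_n) : 'M[K]_n.+1 := vec_coefm v i j *: vec_unit n K i j.

Lemma vec_mul_entry (c c' : nat -> nat -> K) (i j k l : 'I_n) a b :
  (id_plus (fun i j : 'I_n => c i j *: vec_unit n K i j) i j
   * id_plus (fun i j : 'I_n => c' i j *: vec_unit n K i j) k l) a b
  = vec_prod ((1 : 'M_n.+1) a b) (fun i j => vec_unit n K i j a b) c c' i j k l.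
Proof.
rewrite /id_plus /vec_prod -![(_ == _)%:R%:M]scalemx1 mulrDl !mulrDr -!scalerAl -!scalerAr.
rewrite vec_unit_mul // !(mul1r, mulr1) !scalerA.
rewrite -[((i == j :> nat) && _)]/((i == j) && (k == l)) -mulnb natrM !addrA.
move: (vec_unit n K i j) (vec_unit n K k l) (vec_unit n K i l) => e1 e2 e3.
rewrite -[(1 : 'M[K]_n.+1)]/(1%:M) !mxE.
ring.
Qed.

Lemma rtt_pair_vec :
  rtt_pair (v%:M : 'M[K]_n.+1) (v^-1)%:M (id_plus vec_p) (id_plus vec_m).
Proof.
split=> [i|i j ji|i k j l|i k j l|i k j l].
- rewrite /id_plus /vec_p /vec_m /vec_coefp /vec_coefm !eqxx.
  rewrite !(mulrDl, mulrDr) -!scalerAl -!scalerAr !vec_unit_mul // !eqxx.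
  rewrite /= !(mul1r, mulr1) !scalerA !mulr1 -!addrA -!scalerDl.
  by split; rewrite [X in _ + X](_ : _ = 0) ?addr0 //;
    apply/eqP; rewrite scaler_eq0; apply/orP; left; apply/eqP; field.
- rewrite /id_plus /vec_p /vec_m /vec_coefp /vec_coefm -!val_eqE /=.
  rewrite [(i == j :> nat)]eq_sym ltn_eqF // [(i < j)%N]ltnNge (ltnW ji) /=.
  by rewrite !scale0r rmorph0 addr0.
- split; first by apply: defect_Rent_mx => a b; rewrite !vec_mul_entry; apply: vec_prodp.
  by apply: defect_Rent_mx => a b; rewrite !vec_mul_entry; apply: vec_prodm.
- by apply: defect_Rent_mx => a b; rewrite !vec_mul_entry; apply: vec_prodmp.
- by apply: defect_Rzent_mx => a b; rewrite !vec_mul_entry; apply: vec_prodpm.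
Qed.

(** The counit, base of the tower. Its relations are the scalar identities of the vector
    representation with every [E] set to 0. *)
Lemma rtt_pair_trivial m :
  rtt_pair (v%:M : 'M[K]_m) (v^-1)%:M (@id_plus K n m (fun _ _ => 0)) (id_plus (fun _ _ => 0)).
Proof.
have E (c c' : nat -> nat -> K) (i j k l : 'I_n) a b :
    (id_plus (fun _ _ => 0) i j * id_plus (fun _ _ => 0) k l : 'M[K]_m) a b
    = vec_prod ((1 : 'M_m) a b) (fun _ _ => 0) c c' i j k l.
  rewrite /id_plus /vec_prod !addr0 -[_ * _]/(_ *m _) mul_scalar_mx !mxE.
  rewrite -[((i == j :> nat) && _)]/((i == j) && (k == l)) -mulnb natrM.
  by rewrite !mulr0 !addr0 -mulrA; congr (_ * _); case: (_ == _); rewrite ?mul1r ?mul0r ?mul0rn.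
split=> [i|i j ji|i k j l|i k j l|i k j l].
- by rewrite /id_plus eqxx addr0 mul1r.
- by rewrite /id_plus -!val_eqE /= gtn_eqF // ltn_eqF // addr0 rmorph0.
- by split; apply: defect_Rent_mx => a b; rewrite !(E (vec_coefp v) (vec_coefp v)); apply: vec_prodp.
- apply: defect_Rent_mx => a b.
  by rewrite !(E (vec_coefp v) (vec_coefp v)); apply: vec_prodp.
- apply: defect_Rzent_mx => a b.
  rewrite !(E (vec_coefp v) (vec_coefm v)).
  have := vec_prodpm v0 ((1 : 'M_m) a b) (fun _ _ => 0) i j k l.
  by rewrite /vec_prod !mulr0.
Qed.

Definition rep_p r := tower (fun=> 1) (fun=> 1) (fun=> 1) vec_p r.
Definition rep_m r := tower (fun=> 1) (fun=> 1) (fun=> 1) vec_m r.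

Lemma rtt_pair_rep r : rtt_pair (v%:M : 'M[K]_(tower_dim n.+1 r)) (v^-1)%:M
  (id_plus (rep_p r)) (id_plus (rep_m r)).
Proof.
elim: r => [|r IH]; first exact: rtt_pair_trivial.
have ext m (T T' S S' : 'I_n -> 'I_n -> 'M[K]_m) : T =2 T' -> S =2 S' ->
    rtt_pair (v%:M : 'M[K]_m) (v^-1)%:M T S -> rtt_pair (v%:M : 'M[K]_m) (v^-1)%:M T' S'.
  move=> ET ES [H1 H2 H3 H4 H5]; split=> [i|i j ji|i k j l|i k j l|i k j l].
  - by rewrite -ET -ES.
  - by rewrite -ET -ES; exact: H2.
  - by rewrite -(defect_ext _ _ _ _ _ ET ET) -(defect_ext _ _ _ _ _ ES ES).
  - by rewrite -(defect_ext _ _ _ _ _ ES ET).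
  - by rewrite -(defect_ext _ _ _ _ _ ET ES).
apply: (@ext (tower_dim n.+1 r * n.+1)%N
  (coprod (fun i j => tens1l n.+1 (id_plus (rep_p r) i j))
     (fun i j => tens1r (tower_dim n.+1 r) (id_plus vec_p i j))) _
  (coprod (fun i j => tens1l n.+1 (id_plus (rep_m r) i j))
     (fun i j => tens1r (tower_dim n.+1 r) (id_plus vec_m i j)))).
- by move=> i j; rewrite coprod_tens [RHS]id_plus_tower.
- by move=> i j; rewrite coprod_tens [RHS]id_plus_tower.
have Zl m p (x : K) : tens1l p (x%:M : 'M[K]_m) = x%:M.
  by rewrite /tens1l -[x%:M]scalemx1 tensmxZl tensmx11 scalemx1.
have Zr m p (x : K) : tens1r m (x%:M : 'M[K]_p) = x%:M.
  by rewrite /tens1r -[x%:M]scalemx1 tensmxZr tensmx11 scalemx1.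
apply: rtt_pair_coprod.
- by move=> *; rewrite tens1rl tens1lr.
- by move=> *; rewrite tens1rl tens1lr.
- by move=> *; rewrite tens1rl tens1lr.
- by move=> *; rewrite tens1rl tens1lr.
- by have := rtt_pair_morph (@tens1l K (tower_dim n.+1 r) n.+1) IH; rewrite /= !Zl.
- by have := rtt_pair_morph (@tens1r K (tower_dim n.+1 r) n.+1) rtt_pair_vec; rewrite /= !Zr.
Qed.
End VectorRepresentation.

(** The shifted family has the series [- z X(z)]. Evaluation sends [T^-(z)] to [- z] times the image
    of [T^+(z)], so shifts of a single relation give all three loop relations. *)
Lemma RTTtrig_rel_shiftl n (A : pzRingType) (v vi : A) (X Y : 'I_n -> 'I_n -> int -> A) :
  RTTtrig_rel v vi X Y -> RTTtrig_rel v vi (fun i j k => - X i j (k - 1)) Y.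
Proof.
move=> /RTTtrig_rel_defect H; apply/RTTtrig_rel_defect => a b i k j l.
by rewrite !(defectNl, defectNr) H.
Qed.

Lemma RTTtrig_rel_shiftr n (A : pzRingType) (v vi : A) (X Y : 'I_n -> 'I_n -> int -> A) :
  RTTtrig_rel v vi X Y -> RTTtrig_rel v vi X (fun i j k => - Y i j (k - 1)).
Proof.
move=> /RTTtrig_rel_defect H; apply/RTTtrig_rel_defect => a b i k j l.
by rewrite !(defectNl, defectNr) H.
Qed.

Lemma RTTtrig_rel_ext n (A : pzRingType) (v vi : A)
    (X X' Y Y' : 'I_n -> 'I_n -> int -> A) :
  (forall i j, X i j =1 X' i j) -> (forall i j, Y i j =1 Y' i j) ->
  RTTtrig_rel v vi X Y -> RTTtrig_rel v vi X' Y'.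
Proof.
move=> EX EY /RTTtrig_rel_defect H; apply/RTTtrig_rel_defect => a b i k j l.
have EX' c : (fun p q => X p q c) =2 (fun p q => X' p q c) by move=> p q; apply: EX.
have EY' c : (fun p q => Y p q c) =2 (fun p q => Y' p q c) by move=> p q; apply: EY.
by rewrite -(defect_ext _ _ _ _ _ (EX' _) (EY' _)) H (defect_ext _ _ _ _ _ (EX' _) (EY' _)).
Qed.

Lemma rtt_pair_loop_rels n (A : pzRingType) (v vi : A) (tp tm : 'I_n -> 'I_n -> A) :
  (forall a, (v - vi) * a = a * (v - vi)) -> rtt_pair v vi tp tm ->
  loop_rels v vi (fun i j r => ev_assign tp tm (true, i, j, r))
    (fun i j r => ev_assign tp tm (false, i, j, r)).
Proof.
move=> vC P; have [_ _ pp mm mp] := rtt_pair_fin_rels P; case: P => inv tri _ _ pm.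
have H := RTTtrig_rel_ev_series vC pp mm mp pm.
have Ep i j : ev_series tp tm i j =1
    Defs.coefp (fun i j r => ev_assign tp tm (true, i, j, r)) i j.
  by case=> [[|[|k]]|[|k]].
have Em i j : (fun k => - ev_series tp tm i j (k - 1)) =1
    coefm (fun i j r => ev_assign tp tm (false, i, j, r)) i j.
  by case=> [[|[|k]]|[|k]]; rewrite /= ?opprK ?oppr0.
split=> //.
- exact: (RTTtrig_rel_ext Ep Ep H).
- exact: (RTTtrig_rel_ext Em Em (RTTtrig_rel_shiftl (RTTtrig_rel_shiftr H))).
- exact: (RTTtrig_rel_ext Em Ep (RTTtrig_rel_shiftl H)).
Qed.

Lemma in_ideal_I_matrix n (hn : (0 < n)%N) (x : term (lgen n)) m
    (tp tm : 'I_n -> 'I_n -> 'M[Cv]_m) :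
  in_ideal_I hn x -> rtt_pair (vK%:M : 'M[Cv]_m) (vK^-1)%:M tp tm ->
  teval (fun c : CC => (tofrac c%:P : Cv)%:M) vK%:M (vK^-1)%:M (ev_assign tp tm) x = 0.
Proof.
(* Matrices of size 0 form the zero ring, which is no [algType]; there the equation is trivial. *)
case: m tp tm => [|m] tp tm Ix P; first by apply/matrixP => -[].
have vC (a : 'M[Cv]_m.+1) : (vK%:M - (vK^-1)%:M) * a = a * (vK%:M - (vK^-1)%:M).
  by rewrite -raddfB; symmetry; apply: scalar_mxC.
have E (c : Cv) : c%:M = c%:A :> 'M[Cv]_m.+1 by rewrite scalemx1.
have L := rtt_pair_loop_rels vC P; rewrite !E in L *.
rewrite (@teval_ext _ _ _ (fun c : CC => (tofrac c%:P : Cv)%:A) _ _ _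
  (lassign (fun i j r => ev_assign tp tm (true, i, j, r))
    (fun i j r => ev_assign tp tm (false, i, j, r)))).
- apply: (Ix 'M[Cv]_m.+1 _ _ L) => [[|[|s]]||] //=; by rewrite addNr.
- by move=> c; rewrite E.
- by case=> [[[[] i] j] r].
Qed.

(** * Straightening *)

(** Bundles what the kernel condition quantifies over, so that one identity can be asserted for all
    these algebras at once. *)
Record model (n : nat) := Model {
  mcar :> algType CC;
  mv : mcar;
  mvi : mcar;
  mtp : 'I_n -> 'I_n -> mcar;
  mtm : 'I_n -> 'I_n -> mcar;
  mvC : forall a, mv * a = a * mv;
  mvvi : mv * mvi = 1;
  mviv : mvi * mv = 1;
  mrels : fin_rels mv mvi mtp mtm }.

Section ModelRelations.
Variables (n : nat) (M : model n).
Local Notation v := (mv M).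
Local Notation vi := (mvi M).
Local Notation tp := (@mtp n M).
Local Notation tm := (@mtm n M).
Implicit Types (i j k l a b : 'I_n) (T : 'I_n -> 'I_n -> M).

Lemma mviC (x : M) : vi * x = x * vi.
Proof.
rewrite -[LHS]mulr1 -(mvvi M) mulrA -[_ * x * v]mulrA -mvC [vi * (v * x)]mulrA mviv.
by rewrite mul1r.
Qed.

Definition mq (e : int) : M := if e is Posz m then v ^+ m else vi ^+ `|e|%N.

Lemma mqC (e : int) (x : M) : mq e * x = x * mq e.
Proof.
have C (y : M) m : (forall x : M, y * x = x * y) -> y ^+ m * x = x * y ^+ m.
  by move=> yC; elim: m => [|m IH]; rewrite ?mul1r ?mulr1 // exprS -mulrA IH mulrA yC mulrA.
by case: e => m; apply: C => y; rewrite ?mvC ?mviC.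
Qed.

Lemma mqN (e : int) : mq e * mq (- e) = 1.
Proof.
have E m : v ^+ m * vi ^+ m = 1.
  elim: m => [|m IH]; first by rewrite mul1r.
  by rewrite exprS exprSr -mulrA (mulrA (v ^+ m)) IH mul1r mvvi.
have E' m : vi ^+ m * v ^+ m = 1.
  elim: m => [|m IH]; first by rewrite mul1r.
  by rewrite exprS exprSr -mulrA (mulrA (vi ^+ m)) IH mul1r mviv.
by case: e => [[|m]|m] /=; rewrite ?mul1r.
Qed.

Section OneFamily.
Variable T : 'I_n -> 'I_n -> M.
Hypothesis TT : RTT_rel v vi T T.

(** This and the next three rules cover the relative positions of two entries. Each rewrites a
    product that begins with the lexicographically larger entry into products that begin with a
    smaller one. *)
Lemma rtt_row i j l : (j < l)%N -> T i l * T i j = v * (T i j * T i l).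
Proof.
move=> jl; have := (RTT_relE _ _ _ _).1 TT i i j l.
rewrite eqxx ltnn -val_eqE /= ltn_eqF // jl addr0 mulr1 mulrBr -mvC -mviC.
by rewrite addrCA -{1}[vi * _]addr0 => /addrI/esym/eqP; rewrite subr_eq0 => /eqP.
Qed.

Lemma rtt_col i j k : (i < k)%N -> T k j * T i j = v * (T i j * T k j).
Proof.
move=> ik; have := (RTT_relE _ _ _ _).1 TT i k j j.
rewrite eqxx ltnn -val_eqE /= ltn_eqF // ltnNge (ltnW ik) /= !addr0 mul1r.
by move=> ->; rewrite mvC -[RHS]mulrA mviv mulr1.
Qed.

Lemma rtt_anti i j k l : (i < k)%N -> (l < j)%N -> T k l * T i j = T i j * T k l.
Proof.
move=> ik lj; have := (RTT_relE _ _ _ _).1 TT i k j l.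
rewrite -!val_eqE /= ltn_eqF // gtn_eqF // ltnNge (ltnW ik) ltnNge (ltnW lj) /=.
by rewrite !addr0 mul1r mulr1.
Qed.

Lemma rtt_main i j k l : (i < k)%N -> (j < l)%N ->
  T k l * T i j = T i j * T k l - (vi - v) * (T i l * T k j).
Proof.
move=> ik jl; have := (RTT_relE _ _ _ _).1 TT i k j l.
rewrite -!val_eqE /= ltn_eqF // ltn_eqF // ltnNge (ltnW ik) jl /=.
rewrite !addr0 mul1r mulr1 (rtt_anti ik jl) => ->.
by rewrite mulrBr -mvC -mviC -mulrBl addrK.
Qed.
End OneFamily.

Lemma tp_inv i : tp i i * tm i i = 1. Proof. by case: (mrels M) => /(_ i)[]. Qed.
Lemma tm_inv i : tm i i * tp i i = 1. Proof. by case: (mrels M) => /(_ i)[]. Qed.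
Lemma tp_tri i j : (j < i)%N -> tp i j = 0.
Proof. by move=> ji; case: (mrels M) => _ /(_ i j ji)[]. Qed.
Lemma tm_tri i j : (i < j)%N -> tm i j = 0.
Proof. by move=> ji; case: (mrels M) => _ /(_ j i ji)[]. Qed.
Lemma tp_rel : RTT_rel v vi tp tp. Proof. by case: (mrels M). Qed.
Lemma tm_rel : RTT_rel v vi tm tm. Proof. by case: (mrels M). Qed.
Lemma tmp_rel : RTT_rel v vi tm tp. Proof. by case: (mrels M). Qed.

(** The weight of [t_kl], for both signs, under conjugation by [t^+_aa], as an exponent of [v]. *)
Definition qexp a k l : int := (a == l)%:Z - (a == k)%:Z.

Lemma tp_diag_tp a k l : tp a a * tp k l = mq (qexp a k l) * (tp k l * tp a a).
Proof.
have [lk|kl] := ltnP l k; first by rewrite (tp_tri lk) mulr0 mul0r mulr0.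
rewrite /qexp -!val_eqE /=.
have [ak|ka|/val_inj ?] := ltngtP a k.
- have al : (a < l)%N by apply: leq_trans kl.
  rewrite ltn_eqF //= mul1r (rtt_main tp_rel ak al) (@tp_tri k a) //.
  by rewrite !mulr0 subr0.
- have [al|la|/val_inj ?] := ltngtP a l; rewrite /= ?mul1r.
  + by rewrite (rtt_anti tp_rel ka al).
  + by rewrite (rtt_main tp_rel ka la) (@tp_tri a l) // !mulr0 subr0.
  + by subst a; rewrite (rtt_col tp_rel _ ka).
subst a; have [kl'|lk|/val_inj ->] := ltngtP k l; rewrite /= ?mul1r //.
  by rewrite expr1 (rtt_row tp_rel _ kl') mulrA mviv mul1r.
by rewrite ltnNge kl in lk.
Qed.

Lemma tp_diag_tm a k l : tp a a * tm k l = mq (qexp a k l) * (tm k l * tp a a).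
Proof.
have [kl|lk] := ltnP k l; first by rewrite (tm_tri kl) mulr0 mul0r mulr0.
have := (RTT_relE _ _ _ _).1 tmp_rel k a l a.
rewrite [X in _ + X](_ : _ = 0) ?addr0; last first.
  by case: ifP => // ak; rewrite (@tp_tri k a) // !mulr0.
rewrite [X in _ = _ + X -> _](_ : _ = 0) ?addr0; last first.
  by case: ifP => // la; rewrite (@tp_tri a l) // !mul0r.
rewrite /qexp ![a == _]eq_sym.
have [->|ka] := eqVneq k a; have [->|la] := eqVneq l a; rewrite /= ?(mul1r, mulr1) //.
- by rewrite -mviC => /(congr1 (fun x => v * x)); rewrite !mulrA mvvi !mul1r.
- by rewrite expr1 => ->; rewrite mvC -[RHS]mulrA mviv mulr1.
Qed.

Lemma tm_diag_q (x : M) a e :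
  tp a a * x = mq e * (x * tp a a) -> x * tm a a = mq e * (tm a a * x).
Proof.
move=> /(congr1 (fun y => tm a a * y * tm a a)).
rewrite !mulrA tm_inv mul1r => ->; rewrite -!mulrA tp_inv mulr1.
by rewrite [tm a a * _]mulrA -mqC -mulrA.
Qed.

Lemma tp_diagC a b : tp a a * tp b b = tp b b * tp a a.
Proof. by rewrite tp_diag_tp /qexp subrr mul1r. Qed.
End ModelRelations.

(** The pair [(p, m)] encodes the Laurent polynomial [p(v) v^-m] as data independent of the
    model. *)
HB.lock Definition coefv n (M : model n) (c : {poly CC} * nat) : M :=
  horner_alg (mv M) c.1 * mvi M ^+ c.2.

Lemma horner_mvC n (M : model n) p (x : M) :
  horner_alg (mv M) p * x = x * horner_alg (mv M) p.
Proof.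
elim/poly_ind: p => [|p c IH]; first by rewrite rmorph0 mul0r mulr0.
rewrite rmorphD rmorphM /= horner_algC horner_algX mulrDl mulrDr -!mulrA mvC.
by rewrite !mulrA IH -!scalerAl -!scalerAr mul1r mulr1.
Qed.

Lemma mviXC n (M : model n) m (x : M) : mvi M ^+ m * x = x * mvi M ^+ m.
Proof.
elim: m => [|m IH]; first by rewrite mul1r mulr1.
by rewrite exprS -mulrA IH !mulrA (mviC x).
Qed.

Lemma coefvC n (M : model n) c (x : M) : coefv M c * x = x * coefv M c.
Proof. by rewrite coefv.unlock -mulrA mviXC mulrA (horner_mvC c.1 x) mulrA. Qed.

Lemma coefvM n (M : model n) c d :
  coefv M c * coefv M d = coefv M (c.1 * d.1, (c.2 + d.2)%N).
Proof.
by rewrite coefv.unlock /= rmorphM exprD !mulrA -[_ * mvi M ^+ c.2 * _]mulrA mviXC mulrA.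
Qed.

(* A letter [inl (a, b)] stands for [t^+_ab] if [a < b], for [t^+_aa - 1] if [a = b]
   and for [t^-_ab] if [a > b]; the letter [inr a] stands for [t^-_aa]. *)
Definition letter n := ('I_n * 'I_n + 'I_n)%type.

Definition letter_val n (M : model n) (x : letter n) : M :=
  match x with
  | inl (a, b) => if (a < b)%N then mtp M a b else
                  if a == b then mtp M a a - 1 else mtm M a b
  | inr a => mtm M a a
  end.

Definition word n (M : model n) (w : seq (letter n)) : M :=
  \prod_(x <- w) letter_val M x.

(** The list is chosen before the model: the same coefficients can be determined in the tensor
    powers and then used in an arbitrary algebra. *)
Definition spanned n (Q : pred (seq (letter n))) (f : forall M : model n, M) : Prop :=
  exists2 s : seq (({poly CC} * nat) * seq (letter n)),
    all (fun e => Q e.2) s & forall M, f M = \sum_(e <- s) coefv M e.1 * word M e.2.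

Section Spanned.
Variable n : nat.
Implicit Types (Q : pred (seq (letter n))) (f g : forall M : model n, M).

Lemma spanned_ext Q f g : (forall M, f M = g M) -> spanned Q f -> spanned Q g.
Proof. by move=> E [s sQ sE]; exists s => // M; rewrite -E. Qed.

Lemma spanned_sub Q Q' f : (forall w, Q w -> Q' w) -> spanned Q f -> spanned Q' f.
Proof.
by move=> QQ [s sQ sE]; exists s => //; apply/allP => e es; apply/QQ/(allP sQ).
Qed.

Lemma spanned0 Q : spanned Q (fun M => 0).
Proof. by exists [::] => // M; rewrite big_nil. Qed.

Lemma spannedD Q f g : spanned Q f -> spanned Q g -> spanned Q (fun M => f M + g M).
Proof.
move=> [s sQ sE] [t tQ tE]; exists (s ++ t); first by rewrite all_cat sQ.
by move=> M; rewrite big_cat sE tE.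
Qed.

Lemma spanned_coef Q c f : spanned Q f -> spanned Q (fun M => coefv M c * f M).
Proof.
move=> [s sQ sE].
exists [seq ((c.1 * e.1.1, (c.2 + e.1.2)%N), e.2) | e <- s].
  by rewrite all_map.
move=> M; rewrite big_map sE mulr_sumr; apply: eq_bigr => e _.
by rewrite mulrA coefvM.
Qed.

Lemma spanned_word Q w : Q w -> spanned Q (fun M => word M w).
Proof.
move=> Qw; exists [:: ((1, 0%N), w)]; first by rewrite /= Qw.
by move=> M; rewrite big_seq1 coefv.unlock rmorph1 !mul1r.
Qed.

Lemma spanned_cst Q c f : spanned Q f -> spanned Q (fun M => c%:A * f M).
Proof.
move=> /(spanned_coef (c%:P, 0%N)); apply: spanned_ext => M.
by rewrite coefv.unlock horner_algC mulr1.
Qed.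

Lemma spannedN Q f : spanned Q f -> spanned Q (fun M => - f M).
Proof.
by move=> /(spanned_cst (-1)); apply: spanned_ext => M; rewrite scaleN1r mulN1r.
Qed.

Lemma spannedB Q f g : spanned Q f -> spanned Q g -> spanned Q (fun M => f M - g M).
Proof. by move=> sf sg; apply/spannedD/spannedN. Qed.

Lemma spanned_v Q f : spanned Q f -> spanned Q (fun M => mv M * f M).
Proof.
move=> /(spanned_coef ('X, 0%N)); apply: spanned_ext => M.
by rewrite coefv.unlock horner_algX mulr1.
Qed.

Lemma spanned_vi Q f : spanned Q f -> spanned Q (fun M => mvi M * f M).
Proof.
move=> /(spanned_coef (1, 1%N)); apply: spanned_ext => M.
by rewrite coefv.unlock rmorph1 mul1r.
Qed.

Lemma spanned_vB Q f : spanned Q f -> spanned Q (fun M => (mvi M - mv M) * f M).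
Proof.
move=> sf; apply: (@spanned_ext _ (fun M => mvi M * f M - mv M * f M)).
  by move=> M; rewrite mulrBl.
by apply: spannedB; [apply: spanned_vi|apply: spanned_v].
Qed.

Lemma spanned_mq Q e f : spanned Q f -> spanned Q (fun M => mq M e * f M).
Proof.
case: e => m.
  move=> /(spanned_coef ('X^m, 0%N)); apply: spanned_ext => M.
  by rewrite coefv.unlock rmorphXn /= horner_algX mulr1.
move=> /(spanned_coef (1, m.+1)); apply: spanned_ext => M.
by rewrite coefv.unlock rmorph1 mul1r.
Qed.

Lemma word_cat (M : model n) u w : word M (u ++ w) = word M u * word M w.
Proof. exact: big_cat. Qed.

Lemma word_cons (M : model n) x w : word M (x :: w) = letter_val M x * word M w.
Proof. exact: big_cons. Qed.

Lemma word1 (M : model n) x : word M [:: x] = letter_val M x.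
Proof. exact: big_seq1. Qed.

Lemma word0 (M : model n) : word M [::] = 1.
Proof. exact: big_nil. Qed.

(** Coefficients are central, so it suffices to treat each word of [f] inside the context
    [g _ h]. *)
Lemma spanned_bind Q Q' (g h : forall M : model n, M) f : spanned Q f ->
  (forall w, Q w -> spanned Q' (fun M => g M * word M w * h M)) ->
  spanned Q' (fun M => g M * f M * h M).
Proof.
move=> [s sQ sE] H.
apply: (@spanned_ext _ (fun M => \sum_(e <- s) coefv M e.1 * (g M * word M e.2 * h M))).
  move=> M; rewrite sE mulr_sumr mulr_suml; apply: eq_bigr => e _.
  by rewrite !mulrA (coefvC e.1 (g M)).
elim: s sQ {sE} => [_|e s IH /= /andP[eQ sQ]].
  by apply: spanned_ext (spanned0 _) => M; rewrite big_nil.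
apply: spanned_ext (spannedD (spanned_coef e.1 (H _ eQ)) (IH sQ)) => M.
by rewrite big_cons.
Qed.

Lemma spannedM Q1 Q2 Q f g : spanned Q1 f -> spanned Q2 g ->
  (forall u w, Q1 u -> Q2 w -> Q (u ++ w)) -> spanned Q (fun M => f M * g M).
Proof.
move=> sf sg H.
apply: (@spanned_ext _ (fun M => 1 * f M * g M)); first by move=> M; rewrite mul1r.
apply: (spanned_bind sf) => u Qu.
apply: (@spanned_ext _ (fun M => word M u * g M * 1)) => [M|]; first by rewrite mul1r mulr1.
apply: (spanned_bind sg) => w Qw.
apply: (@spanned_ext _ (fun M => word M (u ++ w))) => [M|]; first by rewrite word_cat mulr1.
exact/spanned_word/H.
Qed.

Lemma spanned_tp Q (a b : 'I_n) : (b < a)%N || Q [:: inl (a, b)] -> Q [::] ->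
  spanned Q (fun M => mtp M a b).
Proof.
move=> Qab Q0; have [ab|ba|/val_inj ab] := ltngtP a b.
- apply: (@spanned_ext _ (fun M => word M [:: inl (a, b)])).
    by move=> M; rewrite word1 /= ab.
  by apply: spanned_word; move: Qab; rewrite ltnNge (ltnW ab).
- by apply: spanned_ext (spanned0 _) => M; rewrite (tp_tri M ba).
- subst b; move: Qab; rewrite ltnn /= => Qaa.
  apply: spanned_ext (spannedD (spanned_word Qaa) (spanned_word Q0)) => M.
  by rewrite word0 word1 /= ltnn eqxx subrK.
Qed.

Lemma spanned_tm Q (a b : 'I_n) :
  [|| (a < b)%N, (b < a)%N && Q [:: inl (a, b)] | (a == b) && Q [:: inr a]] ->
  spanned Q (fun M => mtm M a b).
Proof.
rewrite -(inj_eq val_inj) /=; have [ab _|ba|/val_inj ab] /= := ltngtP a b.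
- by apply: spanned_ext (spanned0 _) => M; rewrite (tm_tri M ab).
- rewrite orbF => Qab; apply: spanned_ext (spanned_word Qab) => M.
  by rewrite word1 /= ltnNge (ltnW ba) /= -(inj_eq val_inj) /= gtn_eqF.
- by subst b => Qaa; apply: spanned_ext (spanned_word Qaa) => M; rewrite word1.
Qed.
End Spanned.

Section MoreRelations.
Variables (n : nat) (M : model n).

Lemma mq_swap e (t x : M) : t * x = mq M e * (x * t) -> x * t = mq M (- e) * (t * x).
Proof. by move=> ->; rewrite mulrA (mqC (- e) (mq M e)) mqN mul1r. Qed.

Lemma tm_tp_diagC a b : mtm M a a * mtp M b b = mtp M b b * mtm M a a.
Proof.
have E : mtp M a a * mtp M b b = mq M 0 * (mtp M b b * mtp M a a).
  by rewrite mul1r tp_diagC.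
by rewrite (tm_diag_q E) mul1r.
Qed.

Lemma tm_diagC a b : mtm M a a * mtm M b b = mtm M b b * mtm M a a.
Proof.
have E : mtp M a a * mtm M b b = mq M 0 * (mtm M b b * mtp M a a).
  by rewrite mul1r tm_tp_diagC.
by rewrite (tm_diag_q E) mul1r.
Qed.
End MoreRelations.

(** * The order on letters and the reduction of two-letter words *)

Section LetterOrder.
Variable n : nat.
Implicit Types (x y : letter n) (w : seq (letter n)).

(** Strictly upper [t^+] come first, then [t^+_aa - 1], then [t^-_aa], then strictly lower [t^-]. In
    a sorted word [t^-_aa] is preceded only by letters that [t^+_aa] crosses up to a power of
    [v]. *)
Definition lclass x : nat := match x with
  | inl (a, b) => if (a < b)%N then 0 else if a == b then 1 else 3
  | inr _ => 2 end.
Definition lrow x : 'I_n := match x with inl (a, _) => a | inr a => a end.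
Definition lcol x : 'I_n := match x with inl (_, b) => b | inr a => a end.
Definition lcode x : nat := (lclass x * n + lrow x) * n + lcol x.

Lemma lclass0 (a b : 'I_n) : (a < b)%N -> lclass (inl (a, b)) = 0%N.
Proof. by rewrite /= => ->. Qed.
Lemma lclass1 (a : 'I_n) : lclass (inl (a, a)) = 1%N.
Proof. by rewrite /= ltnn eqxx. Qed.
Lemma lclass3 (a b : 'I_n) : (b < a)%N -> lclass (inl (a, b)) = 3.
Proof. by move=> ba; rewrite /= ltnNge (ltnW ba) -(inj_eq val_inj) /= gtn_eqF. Qed.

Lemma lcode_lt x y : (lcode x < lcode y)%N =
  (lclass x < lclass y)%N || (lclass x == lclass y) &&
    ((lrow x < lrow y)%N || (lrow x == lrow y) && (lcol x < lcol y)%N).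
Proof.
have lt2 p p' a a' : (a < n)%N -> (p < p')%N -> (p * n + a < p' * n + a')%N.
  move=> an pp; apply: (@leq_trans (p' * n)%N); last exact: leq_addr.
  by apply: (@leq_trans (p.+1 * n)%N); [rewrite mulSn addnC ltn_add2r|rewrite leq_mul2r pp orbT].
have lex p p' a a' : (a < n)%N -> (a' < n)%N ->
    (p * n + a < p' * n + a')%N = (p < p')%N || (p == p') && (a < a')%N.
  move=> an an'; have [pp|pp|->] := ltngtP p p'; last by rewrite ltn_add2l.
    by rewrite lt2.
  by rewrite ltnNge ltnW ?lt2.
rewrite /lcode !lex //; have [?|?|E] := ltngtP (lclass x) (lclass y) => //=.
- by rewrite gtn_eqF ?lt2.
- by rewrite E eqn_add2l.
Qed.

Lemma lcode_bound x : (lcode x < 4 * n * n)%N.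
Proof.
rewrite /lcode; have := ltn_ord (lrow x); have := ltn_ord (lcol x).
have : (lclass x <= 3)%N by case: x => [[a b]|a] //=; do 2?case: ifP.
by move: (lclass x) (lrow x : nat) (lcol x : nat) => c r k; nia.
Qed.

Lemma lcode_inj : injective lcode.
Proof.
move=> x y E; have := ltnn (lcode x); rewrite {2}E lcode_lt.
have := ltnn (lcode y); rewrite -{2}E lcode_lt.
have [?|?|Ec] /= := ltngtP (lclass x) (lclass y) => //.
rewrite -!(inj_eq val_inj) /=.
have [?|?|/val_inj Er] /= := ltngtP (lrow x) (lrow y) => //.
have [?|?|/val_inj Ek] /= := ltngtP (lcol x) (lcol y) => // _ _.
case: x y Ec Er Ek {E} => [[a b]|a] [[a' b']|a'] /=.
- by move=> _ -> ->.
- by move=> E ? ?; subst; rewrite ltnn eqxx in E.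
- by move=> E ? ?; subst; rewrite ltnn eqxx in E.
- by move=> _ ->.
Qed.

Definition low (m : nat) w := if w is [:: x] then (lcode x < m)%N else w == [::].
(** In words of length two only the first letter is bounded: words are later compared as numerals,
    and there a drop in the leading digit outweighs whatever follows. *)
Definition reduced (m : nat) w := if w is [:: x; y] then (lcode x < m)%N else (size w <= 1)%N.
Definition short w := (size w <= 1)%N.

Lemma spanned_lowM m (f g : forall M : model n, M) :
  spanned (low m) f -> spanned short g -> spanned (reduced m) (fun M => f M * g M).
Proof.
move=> sf sg; apply: (spannedM sf sg) => [[|x [|z u]] [|y [|t w]]] //=.
Qed.

Lemma short_tp a b : spanned short (fun M : model n => mtp M a b).
Proof. by apply: spanned_tp; rewrite ?orbT. Qed.
Lemma short_tm a b : spanned short (fun M : model n => mtm M a b).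
Proof.
by apply: spanned_tm; rewrite /short /= !andbT -(inj_eq val_inj) /=; case: ltngtP.
Qed.

Lemma low_tp m (a b : 'I_n) : (b < a)%N || (lcode (inl (a, b)) < m)%N ->
  spanned (low m) (fun M : model n => mtp M a b).
Proof. by move=> H; apply: spanned_tp. Qed.

Lemma low_tm m (a b : 'I_n) : [|| (a < b)%N, (b < a)%N && (lcode (inl (a, b)) < m)%N
    | (a == b) && (lcode (inr a) < m)%N] ->
  spanned (low m) (fun M : model n => mtm M a b).
Proof. by move=> H; apply: spanned_tm. Qed.

Lemma spanned_swap x y m : (lcode y < m)%N ->
  (forall M : model n, letter_val M x * letter_val M y = letter_val M y * letter_val M x) ->
  spanned (reduced m) (fun M : model n => letter_val M x * letter_val M y).
Proof.
move=> yx E; apply: (@spanned_ext _ _ (fun M => word M [:: y; x])).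
  by move=> M; rewrite word_cons word1 E.
exact: spanned_word.
Qed.

Lemma tp_tp_reduce (i j k l : 'I_n) : (i < j)%N -> (k < l)%N ->
  (lcode (inl (i, j)) < lcode (inl (k, l)))%N ->
  spanned (reduced (lcode (inl (k, l)))) (fun M : model n => mtp M k l * mtp M i j).
Proof.
move=> ij kl H; have := H; rewrite lcode_lt !lclass0 //= -(inj_eq val_inj) /=.
case: (ltngtP i k) => //= [ik _|/val_inj ?]; last first.
  subst k => jl.
  apply: (@spanned_ext _ _ (fun M => mv M * (mtp M i j * mtp M i l))).
    by move=> M; rewrite (rtt_row (tp_rel M) _ jl).
  by apply/spanned_v/spanned_lowM; [apply: low_tp; rewrite H orbT|apply: short_tp].
case: (ltngtP j l) => [jl|lj|/val_inj ?].
- apply: (@spanned_ext _ _ (fun M => mtp M i j * mtp M k l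
     - (mvi M - mv M) * (mtp M i l * mtp M k j))).
    by move=> M; rewrite (rtt_main (tp_rel M) ik jl).
  apply: spannedB; last apply: spanned_vB; apply: spanned_lowM; try exact: short_tp.
    by apply: low_tp; rewrite H orbT.
  (* The correction [t_il t_kj] begins in row [i < k], hence with a smaller letter. *)
  apply: low_tp; rewrite lcode_lt !lclass0 //= ?ik ?orbT //.
  exact: ltn_trans jl.
- apply: (@spanned_ext _ _ (fun M => mtp M i j * mtp M k l)).
    by move=> M; rewrite (rtt_anti (tp_rel M) ik lj).
  by apply: spanned_lowM; [apply: low_tp; rewrite H orbT|apply: short_tp].
- subst l; apply: (@spanned_ext _ _ (fun M => mv M * (mtp M i j * mtp M k j))).
    by move=> M; rewrite (rtt_col (tp_rel M) _ ik).
  by apply/spanned_v/spanned_lowM; [apply: low_tp; rewrite H orbT|apply: short_tp].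
Qed.

Lemma tm_tm_reduce (i j k l : 'I_n) : (j < i)%N -> (l < k)%N ->
  (lcode (inl (i, j)) < lcode (inl (k, l)))%N ->
  spanned (reduced (lcode (inl (k, l)))) (fun M : model n => mtm M k l * mtm M i j).
Proof.
move=> ij kl H; have := H; rewrite lcode_lt !lclass3 //= -(inj_eq val_inj) /=.
have low_ij : spanned (low (lcode (inl (k, l)))) (fun M : model n => mtm M i j).
  by apply: low_tm; rewrite ij H !orbT.
case: (ltngtP i k) => //= [ik _|/val_inj ?]; last first.
  subst k => jl.
  apply: (@spanned_ext _ _ (fun M => mv M * (mtm M i j * mtm M i l))).
    by move=> M; rewrite (rtt_row (tm_rel M) _ jl).
  by apply/spanned_v/spanned_lowM; [|apply: short_tm].
case: (ltngtP j l) => [jl|lj|/val_inj ?].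
- apply: (@spanned_ext _ _ (fun M => mtm M i j * mtm M k l
     - (mvi M - mv M) * (mtm M i l * mtm M k j))).
    by move=> M; rewrite (rtt_main (tm_rel M) ik jl).
  apply: spannedB; last apply: spanned_vB; apply: spanned_lowM; try exact: short_tm.
    by [].
  apply: low_tm; rewrite -(inj_eq val_inj) /=; have [//|li|/val_inj ?] /= := ltngtP i l.
    by rewrite lcode_lt !lclass3 //= ik.
  by rewrite lcode_lt lclass3.
- apply: (@spanned_ext _ _ (fun M => mtm M i j * mtm M k l)).
    by move=> M; rewrite (rtt_anti (tm_rel M) ik lj).
  by apply: spanned_lowM; [|apply: short_tm].
- subst l; apply: (@spanned_ext _ _ (fun M => mv M * (mtm M i j * mtm M k j))).
    by move=> M; rewrite (rtt_col (tm_rel M) _ ik).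
  by apply/spanned_v/spanned_lowM; [|apply: short_tm].
Qed.

(** One side of the mixed relation: all its terms begin with a [tp], of class 0 or 1, and so are
    reduced relative to any class 3 letter. *)
Definition exch (M : model n) (k l i j : 'I_n) : M :=
  mq M (- (l == j)%:Z) * (mtp M i j * mtm M k l)
  + (if (l < j)%N then (mvi M - mv M) * (mtp M i l * mtm M k j) else 0).

Lemma exchE (M : model n) (k l i j : 'I_n) :
  mq M (- (k == i)%:Z) * (mtm M k l * mtp M i j)
    + (if (i < k)%N then (mvi M - mv M) * (mtm M i l * mtp M k j) else 0)
  = exch M k l i j.
Proof.
have E (b : bool) : (if b then mvi M else 1) = mq M (- b%:Z) by case: b.
have := (RTT_relE _ _ _ _).1 (tmp_rel M) k i l j; rewrite !E => ->.
rewrite /exch mqC; congr (_ + _); case: ifP => // _.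
by rewrite mulrBr mulrBl mvC mviC.
Qed.

(** For [k <= i] the other side of the mixed relation has no flip term, and the product is a power
    of [v] times [exch]. For [i < k] the flip term [t^-_il t^+_kj] has its rows in the good order,
    so the first case applies to it. There [l] may exceed or equal [i], which is why the bound [x]
    is not tied to [(k, l)]. *)
Lemma tm_tp_reduce (x : letter n) (i j k l : 'I_n) : lclass x = 3 ->
  spanned (reduced (lcode x)) (fun M : model n => mtm M k l * mtp M i j).
Proof.
move=> x3.
have low_p (a b : 'I_n) : spanned (low (lcode x)) (fun M : model n => mtp M a b).
  apply: low_tp; case: (ltngtP b a) => //= [ab|/val_inj ->]; rewrite lcode_lt x3.
    by rewrite lclass0.
  by rewrite lclass1.
have sG c d a b : spanned (reduced (lcode x)) (fun M => exch M c d a b).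
  rewrite /exch; apply: spannedD.
    by apply/spanned_mq/spanned_lowM; [|apply: short_tm].
  case: (d < b)%N; last exact: spanned0.
  by apply/spanned_vB/spanned_lowM; [|apply: short_tm].
have le (c d a b : 'I_n) : (c <= a)%N ->
    spanned (reduced (lcode x)) (fun M : model n => mtm M c d * mtp M a b).
  move=> ca; apply: (@spanned_ext _ _ (fun M => mq M (c == a)%:Z * exch M c d a b)).
    by move=> M; rewrite -exchE ltnNge ca addr0 mulrA mqN mul1r.
  exact: spanned_mq.
case: (leqP k i) => [|ik]; first exact: le.
apply: (@spanned_ext _ _ (fun M => exch M k l i j - (mvi M - mv M) * (mtm M i l * mtp M k j))).
  move=> M; rewrite -exchE ik -(inj_eq val_inj) /= gtn_eqF //.
  by rewrite mul1r addrK.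
by apply: spannedB => //; apply/spanned_vB/le/ltnW.
Qed.

Lemma letter_reduce x y : (lcode y < lcode x)%N ->
  spanned (reduced (lcode x)) (fun M : model n => letter_val M x * letter_val M y).
Proof.
move=> H; have := H; rewrite lcode_lt.
have low_y : spanned (low (lcode x)) (fun M : model n => letter_val M y).
  by apply: (@spanned_ext _ _ (fun M => word M [:: y])) => [M|];
    [rewrite word1|apply: spanned_word].
case: x H low_y => [[k l]|c] H low_y.
  have [kl|lk|/val_inj El] := ltngtP k l.
  - case: y H low_y => [[i j]|d] H _; last by rewrite lclass0.
    rewrite (lclass0 kl); have [ij _|ji|/val_inj Ej] := ltngtP i j.
    + by rewrite /= kl ij; apply: tp_tp_reduce.
    + by rewrite lclass3.
    + by rewrite -Ej lclass1.
  - case: y H low_y => [[i j]|d] H low_y _.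
      have [ij|ji|/val_inj Ej] := ltngtP i j.
      + rewrite /= ij ltnNge (ltnW lk) /= -(inj_eq val_inj) /= gtn_eqF //.
        exact/tm_tp_reduce/lclass3.
      + rewrite /= !ltnNge (ltnW lk) (ltnW ji) /= -!(inj_eq val_inj) /= !gtn_eqF //.
        exact: tm_tm_reduce.
      + subst j; apply: (@spanned_ext _ _ (fun M => mq M (- qexp i k l) *
          (mtp M i i * mtm M k l) - mtm M k l)).
          move=> M; rewrite /= ltnn eqxx ltnNge (ltnW lk) /= -!(inj_eq val_inj) /= gtn_eqF //.
          by rewrite mulrBr mulr1 -(mq_swap (tp_diag_tm _ _ _ _)).
        apply: spannedB; last by apply: spanned_sub (short_tm _ _) => -[|? []].
        apply/spanned_mq/spanned_lowM; last exact: short_tm.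
        by apply: low_tp; rewrite H orbT.
    apply: (@spanned_ext _ _ (fun M => mq M (qexp d k l) * (mtm M d d * mtm M k l))).
      move=> M; rewrite /= ltnNge (ltnW lk) /= -!(inj_eq val_inj) /= gtn_eqF //.
      by rewrite (tm_diag_q (tp_diag_tm _ _ _ _)).
    by apply/spanned_mq/spanned_lowM; [|apply: short_tm].
  - subst l; case: y H low_y => [[i j]|d] H low_y; last by rewrite lclass1.
    have [ij _|ji|/val_inj Ej _] := ltngtP i j.
    + apply: (@spanned_ext _ _ (fun M => mq M (qexp k i j) *
          (mtp M i j * mtp M k k) - mtp M i j)).
        by move=> M; rewrite /= ltnn eqxx ij mulrBl mul1r -tp_diag_tp.
      apply: spannedB; last by apply: spanned_sub (short_tp _ _) => -[|? []].
      by apply/spanned_mq/spanned_lowM; [apply: low_tp; rewrite H orbT|apply: short_tp].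
    + by rewrite lclass1 lclass3.
    subst j; apply: spanned_swap => // M; rewrite /= !ltnn !eqxx.
    exact: (commrB (commr_sym (commrB (tp_diagC M i k) (commr1 _))) (commr1 _)).
case: y H low_y => [[i j]|d] H low_y.
  have [ij _|ji|/val_inj Ej _] := ltngtP i j.
  - apply: (@spanned_ext _ _ (fun M => mq M (- qexp c i j) *
          (mtp M i j * mtm M c c))).
      move=> M; rewrite /= ij; apply/esym/mq_swap/tm_diag_q; exact: tp_diag_tp.
    by apply/spanned_mq/spanned_lowM; [apply: low_tp; rewrite H orbT|apply: short_tm].
  - by rewrite lclass3.
  subst j; apply: spanned_swap => // M; rewrite /= !ltnn !eqxx.
  by rewrite mulrBl mulrBr mul1r mulr1 tm_tp_diagC.
by move=> _; apply: spanned_swap => // M; rewrite /= tm_diagC.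
Qed.
End LetterOrder.

(** * Straightening words and clearing the inverses [t^-_aa] *)

Section Straightening.
Variable n : nat.
Implicit Types (x y : letter n) (w u : seq (letter n)) (l : seq 'I_n).

Definition lle x y := (lcode x <= lcode y)%N.

Lemma lle_trans : transitive lle. Proof. by move=> y x z; apply: leq_trans. Qed.
Lemma lle_total : total lle. Proof. by move=> x y; apply: leq_total. Qed.
Lemma lle_anti : antisymmetric lle.
Proof. by move=> x y; rewrite /lle -eqn_leq => /eqP/lcode_inj. Qed.

(* The word read as a numeral in base [4 n^2]: the measure that straightening decreases. *)
Fixpoint wcode w : nat :=
  if w is x :: w' then (lcode x * (4 * n * n) ^ size w' + wcode w')%N else 0%N.

Lemma wcode_bound w : (wcode w < (4 * n * n) ^ size w)%N.
Proof.
elim: w => //= x w IH; apply: (@leq_trans ((lcode x).+1 * (4 * n * n) ^ size w)%N).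
  by rewrite mulSn addnC ltn_add2r.
by rewrite expnS leq_mul2r lcode_bound orbT.
Qed.

Lemma wcode_cat u w : wcode (u ++ w) = (wcode u * (4 * n * n) ^ size w + wcode w)%N.
Proof. by elim: u => //= x u ->; rewrite size_cat expnD mulnDl mulnA addnA. Qed.

Lemma descent w : ~~ sorted lle w ->
  exists u x y u', w = u ++ x :: y :: u' /\ (lcode y < lcode x)%N.
Proof.
elim: w => // x [//|y w] IH /=; have [xy /IH|] := boolP (lle x y).
  by case=> u [x' [y' [u' [-> lt]]]]; exists (x :: u), x', y', u'.
by rewrite /lle -ltnNge => lt _; exists [::], x, y, w.
Qed.

(** At equal length the first changed digit drops. A shorter replacement is smaller because
    [lcode y < lcode x] makes [x] a nonzero leading digit, while the prefix [u] only loses place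
    value. *)
Lemma wcode_reduce u r x y u' : (lcode y < lcode x)%N -> reduced (lcode x) r ->
  (wcode (u ++ r ++ u') < wcode (u ++ x :: y :: u'))%N.
Proof.
move=> yx; set B := (4 * n * n)%N; have B0 : (0 < B)%N by apply: leq_trans (lcode_bound x).
have cons_lt c d v v' : size v = size v' -> (lcode c < lcode d)%N ->
    (wcode (c :: v) < wcode (d :: v'))%N.
  move=> E cd /=; rewrite -E; apply: (@leq_trans ((lcode c).+1 * B ^ size v)%N).
    by rewrite mulSn addnC ltn_add2r wcode_bound.
  by apply: leq_trans (leq_addr _ _); rewrite leq_mul2r cd orbT.
have short_lt v : (size v <= (size u').+1)%N -> (wcode v < wcode (x :: y :: u'))%N.
  move=> sv; apply: leq_trans (wcode_bound v) _.
  apply: (@leq_trans (B ^ (size u').+1)%N); first by rewrite leq_pexp2l.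
  rewrite [wcode _]/= -/B; apply: leq_trans (leq_addr _ _).
  by rewrite leq_pmull // (leq_trans _ yx).
rewrite !(wcode_cat u) -/B; case: r => [|c [|d [|? ?]]] // H; rewrite ?cat_cons ?cat0s.
- apply: (@leq_ltn_trans (wcode u * B ^ size (x :: y :: u') + wcode u')%N).
    by rewrite leq_add2r leq_mul2l leq_pexp2l ?orbT //= -addn2 leq_addr.
  by rewrite ltn_add2l; apply: short_lt.
- apply: (@leq_ltn_trans (wcode u * B ^ size (x :: y :: u') + wcode (c :: u'))%N).
    by rewrite leq_add2r leq_mul2l leq_pexp2l ?orbT.
  by rewrite ltn_add2l; apply: short_lt.
- by rewrite ltn_add2l; apply: (cons_lt c x (d :: u') (y :: u')).
Qed.

Lemma word_straighten w : spanned (sorted lle) (fun M : model n => word M w).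
Proof.
have [m] := ubnP (wcode w); elim: m w => // m IH w wm.
have [|/descent[u [x [y [u' [Ew yx]]]]]] := boolP (sorted lle w).
  exact: spanned_word.
apply: (@spanned_ext _ _ (fun M => word M u * (letter_val M x * letter_val M y) * word M u')).
  by move=> M; rewrite Ew word_cat !word_cons !mulrA.
apply: (spanned_bind (letter_reduce yx)) => r rx.
apply: (@spanned_ext _ _ (fun M => word M (u ++ r ++ u'))).
  by move=> M; rewrite !word_cat mulrA.
by apply: IH; rewrite ltnS in wm; apply: leq_trans wm; rewrite Ew; apply: wcode_reduce.
Qed.

(** The letters [inr] are excluded because [t^+_aa t^-_aa = 1] makes sorted words containing them
    dependent. *)
Definition normal w := sorted lle w && all is_inl w.
Definition denom l (M : model n) : M := \prod_(a <- l) mtp M a a.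

Lemma mq_coefv (M : model n) e :
  mq M e = coefv M (if e is Posz m then ('X^m, 0%N) else (1, `|e|%N)).
Proof.
by case: e => m; rewrite coefv.unlock ?rmorph1 ?mul1r //= rmorphXn /= horner_algX mulr1.
Qed.

Lemma coefv1 (M : model n) : coefv M (1, 0%N) = 1.
Proof. by rewrite coefv.unlock rmorph1 mul1r. Qed.

Lemma tp_diag_letter a x : (lclass x <= 2)%N -> exists c, forall M : model n,
  mtp M a a * letter_val M x = coefv M c * (letter_val M x * mtp M a a).
Proof.
case: x => [[i j]|d].
  have [ij _|ji|/val_inj <- _] := ltngtP i j; last 1 first.
  - exists (1, 0%N) => M; rewrite coefv1 mul1r /= ltnn eqxx.
    exact: (commrB (tp_diagC M a i) (commr1 _)).
  - by exists (if qexp a i j is Posz m then ('X^m, 0%N) else (1, `|qexp a i j|%N)) => M;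
      rewrite -mq_coefv /= ij tp_diag_tp.
  - by rewrite lclass3.
by exists (1, 0%N) => M; rewrite coefv1 mul1r /= tm_tp_diagC.
Qed.

Lemma tp_diag_word a w : all (fun x => (lclass x <= 2)%N) w ->
  exists c, forall M : model n, mtp M a a * word M w = coefv M c * (word M w * mtp M a a).
Proof.
elim: w => [_|x w IH /= /andP[x2 /IH[c Ec]]].
  by exists (1, 0%N) => M; rewrite coefv1 word0 !mul1r mulr1.
have [d Ed] := tp_diag_letter a x2; exists (d.1 * c.1, (d.2 + c.2)%N) => M.
rewrite word_cons mulrA Ed -!mulrA Ec -coefvM [letter_val M x * (coefv _ _ * _)]mulrA.
by rewrite -(coefvC c (letter_val M x)) !mulrA.
Qed.

Lemma lle_class x y : lle x y -> (lclass x <= lclass y)%N.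
Proof.
rewrite /lle leqNgt lcode_lt negb_or -leqNgt => /andP[//].
Qed.

(** [t^+_bb] crosses the smaller letters up to a power of [v]; where the letter [t^+_bb - 1]
    belongs, it splits as 1 plus that letter. *)
Lemma tp_diag_normal b w : normal w -> spanned normal (fun M : model n => mtp M b b * word M w).
Proof.
move=> /andP[sw iw]; set y : letter n := inl (b, b).
have [c Ec] : exists c, forall M : model n,
    mtp M b b * word M w = coefv M c * (word M w + word M (merge lle [:: y] w)).
  have Eb (M : model n) : mtp M b b = 1 + letter_val M y.
    by rewrite /= ltnn eqxx addrC subrK.
  elim: w {sw} iw => [_|x w IH /= /andP[ix iw]].
    by exists (1, 0%N) => M; rewrite coefv1 /= word1 word0 mulr1 mul1r Eb.
  have [yx|] := boolP (lle y x).
    by exists (1, 0%N) => M; rewrite coefv1 !word_cons mul1r Eb mulrDl mul1r.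
  rewrite /lle -ltnNge => /ltnW/lle_class; rewrite lclass1 => x1.
  have [d Ed] := tp_diag_letter b (leq_trans x1 (isT : 1 <= 2)%N).
  have [c Ec] := IH iw; exists (d.1 * c.1, (d.2 + c.2)%N) => M.
  rewrite !word_cons mulrA Ed -!mulrA Ec -coefvM [letter_val M x * (coefv _ _ * _)]mulrA.
  by rewrite -(coefvC c (letter_val M x)) -!mulrA mulrDr.
apply: (@spanned_ext _ _ (fun M => coefv M c * (word M w + word M (merge lle [:: y] w)))).
  by move=> M; rewrite Ec.
apply/spanned_coef/spannedD; apply: spanned_word; rewrite /normal ?sw ?iw //.
rewrite merge_sorted ?sw //; last exact: lle_total.
by rewrite (perm_all _ (permEl (perm_merge _ _ _))) /= iw.
Qed.

Lemma denom_spanned l (f : forall M : model n, M) :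
  spanned normal f -> spanned normal (fun M => denom l M * f M).
Proof.
move=> sf; elim: l => [|a l IH].
  by apply: spanned_ext sf => M; rewrite /denom big_nil mul1r.
apply: (@spanned_ext _ _ (fun M => mtp M a a * (denom l M * f M) * 1)).
  by move=> M; rewrite /denom big_cons mulr1 mulrA.
apply: (spanned_bind IH) => w nw.
by apply: spanned_ext (tp_diag_normal a nw) => M; rewrite mulr1.
Qed.

Lemma denom_cat l l' (M : model n) : denom (l ++ l') M = denom l M * denom l' M.
Proof. exact: big_cat. Qed.

Lemma denomC l l' (M : model n) : denom l M * denom l' M = denom l' M * denom l M.
Proof.
apply: commr_prod => a _; apply/commr_sym; apply: commr_prod => b _.
exact: tp_diagC.
Qed.

(** For [w = u t^-_aa u'], a factor [t^+_aa] on the left crosses [u] up to a power of [v] and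
    cancels [t^-_aa]; the shorter word [u u'] is still sorted. *)
Lemma sorted_denom w : sorted lle w ->
  exists l, spanned normal (fun M : model n => denom l M * word M w).
Proof.
have [m] := ubnP (size w); elim: m w => // m IH w wm sw.
have [iw|] := boolP (all is_inl w).
  exists [::]; apply: spanned_ext (spanned_word (_ : normal w)) => [M|].
    by rewrite /denom big_nil mul1r.
  by rewrite /normal sw.
move=> /allPn[[//|a] /splitPr aw _]; case: w / aw wm sw => u u' wm sw.
move: sw; rewrite (sorted_pairwise lle_trans) pairwise_cat /= => /and3P[].
rewrite allrel_consr => /andP[ua uu'] pu /andP[_ pu'].
have suu' : sorted lle (u ++ u').
  by rewrite (sorted_pairwise lle_trans) pairwise_cat uu' pu.
have [|l sl] := IH (u ++ u') _ suu'.
  by move: wm; rewrite !size_cat /= addnS ltnS.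
have u2 : all (fun x => (lclass x <= 2)%N) u.
  by apply/allP => x xu; apply/(@lle_class _ (inr a))/(allP ua).
have [c Ec] := tp_diag_word a u2.
exists (l ++ [:: a]).
apply: (@spanned_ext _ _ (fun M => coefv M c * (denom l M * word M (u ++ u')))).
  move=> M; rewrite denom_cat /denom big_seq1 -/(denom l M) !word_cat word_cons.
  rewrite -[RHS]mulrA [mtp M a a * _]mulrA Ec -!mulrA [mtp M a a * _]mulrA /= tp_inv mul1r.
  by rewrite [LHS]mulrA (coefvC c (denom l M)) -[LHS]mulrA.
exact: spanned_coef.
Qed.

(** A common denominator: the products [denom] commute, and multiplying by one preserves the span of
    normal words. *)
Lemma spanned_denom f : spanned (sorted lle) f ->
  exists l, spanned normal (fun M : model n => denom l M * f M).
Proof.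
case=> s; elim: s f => [|e s IH] f sQ fE.
  exists [::]; apply: (spanned_ext _ (spanned0 _)) => M.
  by rewrite fE big_nil mulr0.
case/andP: sQ => /sorted_denom[l1 s1] sQ.
have [//|l2 s2] := IH (fun M => \sum_(e <- s) coefv M e.1 * word M e.2) sQ.
exists (l1 ++ l2).
apply: spanned_ext (spannedD (spanned_coef e.1 (denom_spanned l2 s1)) (denom_spanned l1 s2)) => M.
rewrite fE big_cons denom_cat mulrDr; congr (_ + _); last by rewrite mulrA.
by rewrite denomC [RHS]mulrA -(coefvC e.1) -!mulrA.
Qed.

Lemma spanned_term (x : term (lgen n)) : spanned predT (fun M : model n =>
  teval (fun c => c%:A) (mv M) (mvi M) (ev_assign (@mtp n M) (@mtm n M)) x).
Proof.
have s1 : spanned predT (fun M : model n => 1).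
  apply: spanned_ext (spanned_word (isT : predT [::])) => M; exact: word0.
have sp a b : spanned predT (fun M : model n => mtp M a b).
  by apply: spanned_sub (short_tp a b).
have sm a b : spanned predT (fun M : model n => mtm M a b).
  by apply: spanned_sub (short_tm a b).
elim: x => [[[[[] a] b] [|[|r]]]|c| | |x IHx y IHy|x IHx y IHy] //=.
- exact: spannedN.
- exact: spanned0.
- exact: spannedN.
- exact: spanned0.
- by apply: spanned_ext (spanned_cst c s1) => M; rewrite mulr1.
- by apply: spanned_ext (spanned_v s1) => M; rewrite mulr1.
- by apply: spanned_ext (spanned_vi s1) => M; rewrite mulr1.
- exact: spannedD.
- exact: (spannedM IHx IHy).
Qed.

Lemma term_normal_form (x : term (lgen n)) : exists l, spanned normal (fun M : model n =>
  denom l M * teval (fun c => c%:A) (mv M) (mvi M) (ev_assign (@mtp n M) (@mtm n M)) x).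
Proof.
apply: spanned_denom.
apply: (@spanned_ext _ _ (fun M : model n => 1 *
  teval (fun c => c%:A) (mv M) (mvi M) (ev_assign (@mtp n M) (@mtm n M)) x * 1)).
  by move=> M; rewrite mul1r mulr1.
apply: (spanned_bind (spanned_term x)) => w _.
by apply: spanned_ext (word_straighten w) => M; rewrite mul1r mulr1.
Qed.

Lemma denom_inv l (M : model n) : exists d, d * denom l M = 1.
Proof.
elim: l => [|a l [d E]]; first by exists 1; rewrite /denom big_nil mul1r.
exists (d * mtm M a a); rewrite /denom big_cons -/(denom l M).
by rewrite -mulrA (mulrA (mtm M a a)) tm_inv mul1r.
Qed.
End Straightening.

(** * Independence of ordered monomials *)

(** The value 0 at [inr] is a default; only normal words are compared with elements of a model. *)
Definition letter_mx n (R : pzRingType) m (wp wm : 'I_n -> 'I_n -> 'M[R]_m) (x : letter n) :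
    'M[R]_m :=
  match x with inl (a, b) => if (a <= b)%N then wp a b else wm a b | inr _ => 0 end.

Definition word_mx n (R : pzRingType) m (wp wm : 'I_n -> 'I_n -> 'M[R]_m)
    (w : seq (letter n)) : 'M[R]_m := \prod_(x <- w) letter_mx wp wm x.

Lemma word_mx_cons n (R : pzRingType) m (wp wm : 'I_n -> 'I_n -> 'M[R]_m) x w :
  word_mx wp wm (x :: w) = letter_mx wp wm x * word_mx wp wm w.
Proof. exact: big_cons. Qed.

(** Splittings into two complementary subsequences, that is, the terms of the coproduct of a product
    of primitive elements. *)
Fixpoint unshuffles (T : Type) (w : seq T) : seq (seq T * seq T) :=
  if w is x :: w' then [seq (x :: u.1, u.2) | u <- unshuffles w']
                    ++ [seq (u.1, x :: u.2) | u <- unshuffles w']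
  else [:: ([::], [::])].

Lemma unshuffles_perm (T : eqType) (w : seq T) u :
  u \in unshuffles w -> perm_eq w (u.1 ++ u.2).
Proof.
elim: w u => [|x w IH] u /=; first by rewrite inE => /eqP ->.
rewrite mem_cat => /orP[] /mapP[u' /IH wu ->] /=; first by rewrite perm_cons.
by rewrite perm_sym perm_catC /= perm_cons perm_catC perm_sym.
Qed.

Lemma unshuffles_nil (T : eqType) (w : seq T) : (w, [::]) \in unshuffles w.
Proof.
elim: w => [|x w IH] /=; first by rewrite inE.
by rewrite mem_cat; apply/orP; left; apply/mapP; exists (w, [::]).
Qed.

Lemma unshuffles1 (T : eqType) (w : seq T) x :
  x \in w -> exists w', (w', [:: x]) \in unshuffles w.
Proof.
elim: w => //= y w IH; rewrite inE => /orP[/eqP <-|/IH[w' xw']].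
  exists w; rewrite mem_cat; apply/orP; right.
  by apply/mapP; exists (w, [::]) => //; apply: unshuffles_nil.
by exists (y :: w'); rewrite mem_cat; apply/orP; left; apply/mapP; exists (w', [:: x]).
Qed.

Section ClassicalLimit.
Variables (n : nat) (R : comPzRingType) (ep em : 'I_n -> 'I_n -> 'M[R]_n.+1).
Local Notation tp r := (tower (fun=> 1) (fun=> 1) (fun=> 0) ep r).
Local Notation tm r := (tower (fun=> 1) (fun=> 1) (fun=> 0) em r).
Local Notation lie_word r w := (word_mx (tp r) (tm r) w).

(** With last weight 0 the tower loses its quadratic term, and letters act as primitive elements. *)
Lemma lie_letter r x : letter_mx (tp r.+1) (tm r.+1) x =
  1%:M *t letter_mx ep em x + letter_mx (tp r) (tm r) x *t 1%:M.
Proof.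
case: x => [[a b]|a] /=; last by rewrite tensmx0 tens0mx addr0.
by case: ifP; rewrite /= !scale1r scale0r addr0.
Qed.

Lemma lie_word_unshuffle r w : lie_word r.+1 w =
  \sum_(u <- unshuffles w) lie_word r u.1 *t word_mx ep em u.2.
Proof.
elim: w => [|x w IH]; first by rewrite big_seq1 /word_mx !big_nil tensmx11.
rewrite word_mx_cons IH lie_letter /= big_cat !big_map /= addrC mulrDl.
by congr (_ + _); rewrite mulr_sumr; apply: eq_bigr => u _;
  rewrite word_mx_cons [LHS]tensmx_mul mul1mx.
Qed.

(* Contraction of the last tensor factor with the matrix coefficient [(a, b)], corrected by
   the coefficient [(0, 0)] so that it vanishes on the identity. *)
Definition contract m (x : letter n) (W : 'M[R]_(m * n.+1)) : 'M[R]_m :=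
  match x with
  | inl (a, b) => \matrix_(i, j) (W (mxtens_index (i, lift ord0 a)) (mxtens_index (j, lift ord0 b))
      - (a == b)%:R * W (mxtens_index (i, ord0)) (mxtens_index (j, ord0)))
  | inr _ => 0
  end.

Definition contract_coef (x : letter n) (B : 'M[R]_n.+1) : R :=
  match x with
  | inl (a, b) => B (lift ord0 a) (lift ord0 b) - (a == b)%:R * B ord0 ord0
  | inr _ => 0
  end.

Lemma contract_tens m x (A : 'M[R]_m) B : contract x (A *t B) = contract_coef x B *: A.
Proof.
case: x => [[a b]|a]; last by rewrite scale0r.
apply/matrixP => i j; rewrite mxE !tensmxE [RHS]mxE mulrBl -mulrA.
by congr (_ - _ * _); apply: mulrC.
Qed.

Lemma contractD m x a (V W : 'M[R]_(m * n.+1)) :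
  contract x (a *: V + W) = a *: contract x V + contract x W.
Proof.
case: x => [[c d]|c]; last by rewrite scaler0 addr0.
apply/matrixP => i j; rewrite !mxE mulrDr opprD addrACA mulrBr.
by rewrite !mulrA [_ * a]mulrC.
Qed.

Fixpoint contract_word (u : seq (letter n)) : 'M[R]_(tower_dim n.+1 (size u)) -> R :=
  match u with
  | [::] => fun W => W ord0 ord0
  | x :: u' => fun W => contract_word (contract x W)
  end.

Lemma contract_wordD u a (V W : 'M[R]_(tower_dim n.+1 (size u))) :
  contract_word (a *: V + W) = a * contract_word V + contract_word W.
Proof.
elim: u V W => [|x u IH] V W /=; first by rewrite !mxE.
by rewrite [contract _ _]contractD IH.
Qed.

Lemma contract_word_sum u (I : eqType) (s : seq I) (c : I -> R)
    (F : I -> 'M[R]_(tower_dim n.+1 (size u))) :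
  contract_word (\sum_(i <- s) c i *: F i) = \sum_(i <- s) c i * contract_word (F i).
Proof.
elim: s => [|i s IH]; rewrite ?big_nil ?big_cons ?contract_wordD ?IH //.
by have := contract_wordD 1 0 (0 : 'M[R]_(tower_dim n.+1 (size u)));
  rewrite scaler0 addr0 mul1r => /eqP; rewrite -subr_eq subrr eq_sym => /eqP.
Qed.

Definition contraction u w : R := contract_word (lie_word (size u) w).

Lemma contraction_cons x u w : contraction (x :: u) w =
  \sum_(p <- unshuffles w) contract_coef x (word_mx ep em p.2) * contraction u p.1.
Proof.
rewrite /contraction -contract_word_sum /=; congr contract_word.
rewrite lie_word_unshuffle.
elim: (unshuffles w) => [|p s IH]; rewrite ?big_nil ?big_cons.
  have := @contractD (tower_dim n.+1 (size u)) x 1 0 0.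
  by rewrite scaler0 addr0 scale1r => /eqP; rewrite -subr_eq subrr eq_sym => /eqP.
by rewrite -IH -contract_tens -[X in contract x X]/(_ + _) -{1}[_ *t _]scale1r contractD scale1r.
Qed.

Lemma contract_coef1 x : contract_coef x 1%:M = 0.
Proof.
case: x => [[a b]|//] /=; rewrite !mxE (inj_eq lift_inj) /= mulr1 subrr //.
Qed.

(** With fewer letters than tensor factors, some factor receives the empty word, hence the identity,
    which the corrected coefficient kills. *)
Lemma contraction_small u w : (size w < size u)%N -> contraction u w = 0.
Proof.
elim: u w => // x u IH w /= wu; rewrite contraction_cons big_seq big1 // => p pw.
have := perm_size (unshuffles_perm pw); rewrite size_cat => sz.
case: p pw sz => w1 [|y w2] /= pw sz; first by rewrite /word_mx big_nil contract_coef1 mul0r.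
rewrite IH ?mulr0 // -ltnS; apply: leq_trans wu; rewrite ltnS sz addnS ltnS leq_addr //.
Qed.

Variable kappa : letter n -> R.
Hypothesis coef_letter : forall x y, is_inl x -> is_inl y ->
  contract_coef x (letter_mx ep em y) = (x == y)%:R * kappa x.

(** With as many letters as factors, each factor must receive exactly one, and [coef_letter] forces
    it to be the letter of [u] there. [N] counts these matchings. *)
Lemma contraction_perm u w : all is_inl u -> all is_inl w -> size w = size u ->
  exists2 N : nat, contraction u w = N%:R * \prod_(x <- u) kappa x & (0 < N)%N = perm_eq u w.
Proof.
elim: u w => [|x u IH] w.
  case: w => // _ _ _; exists 1%N => //.
  by rewrite /contraction /= /word_mx !big_nil mxE eqxx mul1r.
move=> /= /andP[ix iu] iw sw.
have EN p : p \in unshuffles w -> exists N : nat,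
    contract_coef x (word_mx ep em p.2) * contraction u p.1
      = N%:R * (kappa x * \prod_(y <- u) kappa y)
    /\ (0 < N)%N = (p.2 == [:: x]) && perm_eq u p.1.
  move=> pw; have pp := unshuffles_perm pw.
  have := perm_size pp; rewrite size_cat sw => sz.
  have := perm_all is_inl pp; rewrite iw all_cat => /esym/andP[i1 i2].
  case: p pw pp sz i1 i2 => w1 [|y [|z w2]] pw pp sz i1 i2 /=.
  - by exists 0%N; rewrite /word_mx big_nil contract_coef1 !mul0r.
  - have [] := IH w1 iu i1; first by move: sz; rewrite addn1 => -[].
    move=> N -> N0; exists ((x == y) * N)%N.
    rewrite /word_mx big_seq1 coef_letter //; last by case/andP: i2.
    rewrite natrM; split; first by rewrite -!mulrA; congr (_ * _); rewrite mulrCA.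
    by rewrite muln_gt0 N0 eqseq_cons andbT [y == x]eq_sym lt0b.
  - exists 0%N; rewrite contraction_small ?mulr0 ?mul0r ?andbF //=.
      by rewrite eqseq_cons andbF.
    by rewrite -ltnS sz !addnS ltnS leq_addr.
(* Stated for arbitrary lists of splittings to allow induction. The multiplicities are natural
   numbers, so contributions cannot cancel. *)
have EN' : forall s, {subset s <= unshuffles w} -> exists N : nat,
    \sum_(p <- s) contract_coef x (word_mx ep em p.2) * contraction u p.1
      = N%:R * (kappa x * \prod_(y <- u) kappa y)
    /\ (0 < N)%N = has (fun p => (p.2 == [:: x]) && perm_eq u p.1) s.
  elim=> [|p s IHs] ss; first by exists 0%N; rewrite big_nil mul0r.
  have [N [EN1 EN2]] := EN p (ss _ (mem_head _ _)).
  have [|N' [EN1' EN2']] := IHs; first by move=> q qs; apply: ss; rewrite inE qs orbT.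
  exists (N + N')%N; rewrite big_cons EN1 EN1' -mulrDl natrD; split=> //=.
  by rewrite addn_gt0 EN2 EN2'.
have [N [N1 N2]] := EN' (unshuffles w) (fun _ => id).
exists N; first by rewrite contraction_cons N1 big_cons.
rewrite N2; apply/hasP/idP => [[[w1 w2] pw /= /andP[/eqP E uw]]|xuw].
  have := unshuffles_perm pw; rewrite E /= => H.
  rewrite perm_sym; apply: (perm_trans H); rewrite perm_catC /= perm_cons perm_sym //.
have xw : x \in w by rewrite -(perm_mem xuw) mem_head.
have [w' pw] := unshuffles1 xw; exists (w', [:: x]) => //=; rewrite eqxx /=.
have := unshuffles_perm pw => /= H.
by have := perm_trans xuw H; rewrite perm_sym perm_catC /= perm_cons perm_sym.
Qed.
End ClassicalLimit.

Section Independence.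
Variables (n : nat) (R : numFieldType) (ep em : 'I_n -> 'I_n -> 'M[R]_n.+1).
Variable kappa : letter n -> R.
Hypothesis coef_letter : forall x y, is_inl x -> is_inl y ->
  contract_coef x (letter_mx ep em y) = (x == y)%:R * kappa x.
Hypothesis kappa_neq0 : forall x, kappa x != 0.
Variable ws : seq (seq (letter n)).
Hypotheses (ws_uniq : uniq ws) (ws_normal : all (@normal n) ws).

Definition lie_word r w := word_mx (tower (fun=> 1) (fun=> 1) (fun=> 0) ep r)
  (tower (fun=> 1) (fun=> 1) (fun=> 0) em r) w.

(** Longest words first. On the tensor power of exponent [size u], contraction along [u] kills
    shorter words, longer ones already have coefficient 0, and another normal word of the same
    length is no permutation of [u], both being sorted. *)
Lemma lie_word_free (c : seq (letter n) -> R) :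
  (forall r, \sum_(w <- ws) c w *: lie_word r w = 0) -> forall w, w \in ws -> c w = 0.
Proof.
move=> H; pose L := \max_(w <- ws) size w.
have wL w : w \in ws -> (size w <= L)%N.
  by move=> ww; rewrite /L (big_rem w) //= leq_maxl.
move=> w; have [k] := ubnP (L - size w); elim: k w => // k IH u uk uws.
have /andP[su iu] := allP ws_normal _ uws.
have E := contract_word_sum ws c (lie_word (size u)).
move: E; rewrite H (_ : contract_word 0 = 0); last first.
  have := contract_wordD 1 0 (0 : 'M[R]_(tower_dim n.+1 (size u))).
  by rewrite scaler0 addr0 mul1r => /eqP; rewrite -subr_eq subrr eq_sym => /eqP.
rewrite (big_rem u) //= big_seq big1 ?addr0 => [|w].
  have [N EN N0] := contraction_perm coef_letter iu iu (erefl _).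
  rewrite -/(contraction ep em u u) EN => /esym/eqP.
  rewrite perm_refl in N0.
  by rewrite !mulf_eq0 pnatr_eq0 eqn0Ngt N0 prodf_seq_eq0 /= (introF hasP) ?orbF => [/eqP|[x _ /=]];
    rewrite ?(negPf (kappa_neq0 _)).
rewrite mem_rem_uniq // inE => /andP[wu wws].
have /andP[sw iw] := allP ws_normal _ wws.
rewrite -/(contraction ep em u w).
have [lt|gt|eq] := ltngtP (size w) (size u).
- by rewrite contraction_small // mulr0.
- rewrite IH ?mul0r //; rewrite ltnS in uk; apply: leq_trans uk.
  by rewrite ltn_sub2l // (leq_trans gt) ?wL.
have [N -> N0] := contraction_perm coef_letter iu iw eq.
suff /negbTE puw : ~~ perm_eq u w.
  by move: N0; rewrite puw lt0n => /negbFE/eqP ->; rewrite mul0r mulr0.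
apply: contra wu => uw; apply/eqP/esym.
by apply: (sorted_eq (@lle_trans n) (@lle_anti n)).
Qed.

(* Descent on powers of [X - 1]. *)
Lemma word_free_at1 (G : forall r, seq (letter n) -> 'M[{poly R}]_(tower_dim n.+1 r))
    (d : seq (letter n) -> {poly R}) :
  (forall r w, map_mx (horner_eval 1) (G r w) = lie_word r w) ->
  (forall r, \sum_(w <- ws) d w *: G r w = 0) -> forall w, w \in ws -> d w = 0.
Proof.
move=> G1 H; pose m := \max_(w <- ws) size (d w).
have : forall w, w \in ws -> (size (d w) <= m)%N.
  by move=> w ww; rewrite /m (big_rem w) //= leq_maxl.
move: m => m; elim: m d H => [|m IH] d H dm.
  by move=> w /dm; rewrite leqn0 size_poly_eq0 => /eqP.
have d1 w : w \in ws -> (d w).[1] = 0.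
  apply: (@lie_word_free (fun w => (d w).[1])) => r.
  transitivity (map_mx (horner_eval (1 : R)) (\sum_(w <- ws) d w *: G r w)).
    by rewrite raddf_sum; apply: eq_bigr => u _; rewrite /= map_mxZ /= G1.
  by rewrite H map_mx0.
pose h : {poly R} := 'X - 1%:P; have h0 : h != 0 by rewrite polyXsubC_eq0.
pose q w := d w %/ h.
have dq w : w \in ws -> d w = h * q w.
  move=> /d1 dw; rewrite mulrC /q divpK // dvdp_XsubCl; exact/rootP.
have q0 w : w \in ws -> q w = 0.
  apply: IH => [r|u uws].
    apply/eqP; have := scalemx_eq0 h (\sum_(w <- ws) q w *: G r w).
    rewrite (negPf h0) /= => <-; rewrite scaler_sumr -[X in _ == X](H r); apply/eqP.
    by rewrite big_seq [RHS]big_seq; apply: eq_bigr => u uws; rewrite scalerA -dq.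
  by rewrite /q size_divp // size_XsubC leq_subLR add1n dm.
by move=> w wws; rewrite dq // q0 // mulr0.
Qed.
End Independence.

(** * Rescaling by [v - 1] and the limit at [v = 1] *)

Lemma tower_map (R S : comPzRingType) (f : {rmorphism R -> S}) n p (al be ga : nat -> R)
    (a : 'I_n -> 'I_n -> 'M[R]_p) r i j :
  map_mx f (tower al be ga a r i j) =
  tower (f \o al) (f \o be) (f \o ga) (fun i j => map_mx f (a i j)) r i j.
Proof.
elim: r i j => [|r IH] i j /=; first by rewrite map_mx0.
rewrite !map_mxD !map_mxZ !map_mxT /= map_mx1 map_mx1 IH; congr (_ + _ *: _).
rewrite raddf_sum; apply: eq_bigr => k _ /=; by rewrite map_mxT IH.
Qed.

(** Origin of the weights: multiplied by [v^(r+1)], the linear terms [1 (x) a] and [W (x) 1] yield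
    one factor [h] each, while [W (x) a] yields two. The spare [h] becomes its weight, so at [h = 0]
    the coproduct turns primitive. *)
Lemma tower_scale (R : comPzRingType) (v h : R) n p (a z : 'I_n -> 'I_n -> 'M[R]_p) :
  (forall i j, v *: a i j = h *: z i j) -> forall r i j,
  v ^+ r *: tower (fun=> 1) (fun=> 1) (fun=> 1) a r i j
  = h *: tower (fun r => v ^+ r) (fun=> v) (fun=> h) z r i j.
Proof.
move=> E; elim=> [|r IH] i j /=; first by rewrite !scaler0.
rewrite !scale1r !scalerDr exprS; congr (_ + _ + _).
- by rewrite mulrC -scalerA -tensmxZr E tensmxZr !scalerA mulrC.
- by rewrite -scalerA -tensmxZl IH tensmxZl !scalerA mulrC.
rewrite !scaler_sumr; apply: eq_bigr => k _.
rewrite mulrC -[LHS]scalerA -tensmxZr E -tensmxZl IH tensmxZl tensmxZr.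
by rewrite !scalerA.
Qed.

Lemma word_mx_map n (R S : pzRingType) (f : {rmorphism R -> S}) m
    (wp wm : 'I_n -> 'I_n -> 'M[R]_m) w :
  map_mx f (word_mx wp wm w) =
  word_mx (fun i j => map_mx f (wp i j)) (fun i j => map_mx f (wm i j)) w.
Proof.
rewrite /word_mx rmorph_prod; apply: eq_bigr => -[[a b]|a] _ /=; last by rewrite map_mx0.
by case: ifP.
Qed.

Lemma word_mx_scale n (R : comPzRingType) m (v h : R)
    (wp wm zp zm : 'I_n -> 'I_n -> 'M[R]_m) w :
  (forall i j, v *: wp i j = h *: zp i j) -> (forall i j, v *: wm i j = h *: zm i j) ->
  v ^+ size w *: word_mx wp wm w = h ^+ size w *: word_mx zp zm w.
Proof.
move=> Ep Em; elim: w => [|x w IH]; first by rewrite /word_mx !big_nil.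
have Ex : v *: letter_mx wp wm x = h *: letter_mx zp zm x.
  by case: x => [[a b]|a] /=; [case: ifP|rewrite !scaler0].
have Z (s t : R) (A B : 'M[R]_m) : (s * t) *: (A * B) = (s *: A) * (t *: B).
  by rewrite -!mulmxE -scalemxAl -scalemxAr scalerA.
by rewrite !word_mx_cons !exprS !Z Ex IH.
Qed.

Lemma tower_ext (R : comPzRingType) n p (al al' be be' ga ga' : nat -> R)
    (a a' : 'I_n -> 'I_n -> 'M[R]_p) r :
  al =1 al' -> be =1 be' -> ga =1 ga' -> a =2 a' ->
  tower al be ga a r =2 tower al' be' ga' a' r.
Proof.
move=> Eal Ebe Ega Ea; elim: r => //= r IH i j.
rewrite Eal Ebe Ega Ea IH; congr (_ + _ *: _).
by apply: eq_bigr => k _; rewrite Ea IH.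
Qed.

Lemma word_mx_ext n (R : pzRingType) m (wp wm wp' wm' : 'I_n -> 'I_n -> 'M[R]_m) :
  wp =2 wp' -> wm =2 wm' -> word_mx wp wm =1 word_mx wp' wm'.
Proof.
move=> Ep Em w; apply: eq_bigr => -[[a b]|a] _ //=.
by case: ifP.
Qed.

Section Lattice.
Variable n : nat.

(* [v vec_coef = (v - 1) lat_coef]. *)
Definition lat_coefp (i j : nat) : {poly CC} :=
  if i == j then -1 else if (i < j)%N then - (1 + 'X) else 0.
Definition lat_coefm (i j : nat) : {poly CC} :=
  if i == j then 'X else if (j < i)%N then 1 + 'X else 0.

Definition lat_p (i j : 'I_n) := lat_coefp i j *: vec_unit n {poly CC} i j.
Definition lat_m (i j : 'I_n) := lat_coefm i j *: vec_unit n {poly CC} i j.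

Definition lat_word r (w : seq (letter n)) : 'M[{poly CC}]_(tower_dim n.+1 r) :=
  word_mx (tower (fun r => 'X ^+ r) (fun=> 'X) (fun=> 'X - 1) lat_p r)
          (tower (fun r => 'X ^+ r) (fun=> 'X) (fun=> 'X - 1) lat_m r) w.

Lemma vec_unit_map (R S : pzRingType) (f : {rmorphism R -> S}) i j :
  map_mx f (vec_unit n R i j) = vec_unit n S i j.
Proof. by apply/matrixP => a b; rewrite !mxE rmorph_nat. Qed.

Lemma vec_lat_p (i j : 'I_n) :
  vK *: vec_p vK i j = (vK - 1) *: map_mx (@tofrac {poly CC}) (lat_p i j).
Proof.
rewrite /vec_p /lat_p map_mxZ /= vec_unit_map !scalerA; congr (_ *: _).
rewrite /vec_coefp /lat_coefp; case: ifP => _; [|case: ifP => _].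
- by rewrite mulrBr divff ?vK_neq0 // mulr1 rmorphN1 mulrN1 opprB.
- rewrite mulrBr divff ?vK_neq0 // rmorphN rmorphD rmorph1 -/vK; ring.
- by rewrite rmorph0 !mulr0.
Qed.

Lemma vec_lat_m (i j : 'I_n) :
  vK *: vec_m vK i j = (vK - 1) *: map_mx (@tofrac {poly CC}) (lat_m i j).
Proof.
rewrite /vec_m /lat_m map_mxZ /= vec_unit_map !scalerA; congr (_ *: _).
rewrite /vec_coefm /lat_coefm; case: ifP => _; [|case: ifP => _].
- by rewrite -/vK mulrC.
- rewrite mulrBr divff ?vK_neq0 // rmorphD rmorph1 -/vK; ring.
- by rewrite rmorph0 !mulr0.
Qed.

(** Each letter contributes one factor [v - 1] and a denominator [v^r]; what remains is a matrix of
    polynomials that can be evaluated at [v = 1]. *)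
Lemma rep_word_lat r (w : seq (letter n)) :
  vK ^+ (r * size w) *: word_mx (rep_p vK r) (rep_m vK r) w
  = (vK - 1) ^+ size w *: map_mx (@tofrac {poly CC}) (lat_word r w).
Proof.
rewrite exprM /lat_word word_mx_map; apply: word_mx_scale => i j.
  rewrite /rep_p (tower_scale vec_lat_p) tower_map; congr (_ *: _).
  by apply: tower_ext => // k; rewrite /= ?rmorphXn ?rmorphB ?rmorph1.
rewrite /rep_m (tower_scale vec_lat_m) tower_map; congr (_ *: _).
by apply: tower_ext => // k; rewrite /= ?rmorphXn ?rmorphB ?rmorph1.
Qed.

Definition cl_p (i j : 'I_n) := (lat_coefp i j).[1] *: vec_unit n CC i j.
Definition cl_m (i j : 'I_n) := (lat_coefm i j).[1] *: vec_unit n CC i j.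

Lemma lat_word_at1 r w : map_mx (horner_eval (1 : CC)) (lat_word r w) = lie_word cl_p cl_m r w.
Proof.
rewrite /lat_word word_mx_map; apply: word_mx_ext => i j; rewrite tower_map;
apply: tower_ext => [k|k|k|k l] /=;
by rewrite ?map_mxZ ?vec_unit_map /= /horner_eval ?hornerE ?expr1n ?subrr.
Qed.

(** On [inl] the values are -2, -1 and 2, nonzero in characteristic 0; the 1 at [inr] is a nonzero
    default. *)
Definition cl_kappa (x : letter n) : CC := match x with
  | inl (a, b) => if (a <= b)%N then (lat_coefp a b).[1] else (lat_coefm a b).[1]
  | inr _ => 1
  end.

Lemma cl_kappa_neq0 x : cl_kappa x != 0.
Proof.
case: x => [[a b]|a] /=; last exact: oner_neq0.
rewrite /lat_coefp /lat_coefm; case: (ltngtP a b) => _; rewrite !hornerE.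
- by rewrite oppr_eq0 (_ : 1 + 1 = 2%:R) ?pnatr_eq0 // -natrD.
- by rewrite (_ : 1 + 1 = 2%:R) ?pnatr_eq0 // -natrD.
- by rewrite oppr_eq0 oner_neq0.
Qed.

(** The units avoid coordinate 0, so the [(0, 0)] correction vanishes on them and contraction reads
    off a plain matrix coefficient. *)
Lemma cl_coef_letter x y : is_inl x -> is_inl y ->
  contract_coef x (letter_mx cl_p cl_m y) = (x == y)%:R * cl_kappa x.
Proof.
case: x y => [[a b]|//] [[c d]|//] _ _ /=.
have E k : contract_coef (inl (a, b)) (k *: vec_unit n CC c d) = ((a, b) == (c, d))%:R * k.
  by rewrite /= !mxE /= !mulr0 subr0 xpair_eqE mulrC -!val_eqE.
transitivity (((a, b) == (c, d))%:R *
    (if (c <= d)%N then (lat_coefp c d).[1] else (lat_coefm c d).[1])).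
  by rewrite -E; case: ifP.
rewrite -[inl (a, b) == _]/((a, b) == (c, d)).
by have [[-> ->]|_] := eqVneq (a, b) (c, d); rewrite ?mul0r.
Qed.
End Lattice.

(** * The ideal is contained in the kernel *)

(** The uniform normal form is applied to a matrix model, where the term vanishes by the ideal
    hypothesis and the coefficients become scalars of [C(v)]. *)
Lemma normal_relation n (hn : (0 < n)%N) (x : term (lgen n)) l
    (s : seq (({poly CC} * nat) * seq (letter n))) :
  all (fun e => normal e.2) s ->
  (forall M : model n,
    denom l M * teval (fun c => c%:A) (mv M) (mvi M) (ev_assign (@mtp n M) (@mtm n M)) x
    = \sum_(e <- s) coefv M e.1 * word M e.2) ->
  in_ideal_I hn x ->
  forall m (wp wm : 'I_n -> 'I_n -> 'M[Cv]_m),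
    rtt_pair (vK%:M : 'M[Cv]_m) (vK^-1)%:M (id_plus wp) (id_plus wm) ->
    \sum_(e <- s) ((tofrac e.1.1 : Cv) * vK^-1 ^+ e.1.2) *: word_mx wp wm e.2 = 0.
Proof.
move=> sN sE Ix m wp wm P; have T0 := in_ideal_I_matrix Ix P.
case: m wp wm P T0 => [|m] wp wm P T0; first by apply/matrixP => -[].
have vC (a : restr 'M[Cv]_m.+1) : (vK%:M : restr 'M[Cv]_m.+1) * a = a * vK%:M.
  by symmetry; apply: scalar_mxC.
have vvi : (vK%:M : restr 'M[Cv]_m.+1) * (vK^-1)%:M = 1.
  by rewrite -[_ * _]scalar_mxM divff ?vK_neq0.
have viv : ((vK^-1)%:M : restr 'M[Cv]_m.+1) * vK%:M = 1.
  by rewrite -[_ * _]scalar_mxM mulVf ?vK_neq0.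
pose M := @Model n (restr 'M[Cv]_m.+1) vK%:M (vK^-1)%:M (id_plus wp) (id_plus wm)
  vC vvi viv (rtt_pair_fin_rels P).
have cE (c : CC) : (c%:A : restr 'M[Cv]_m.+1) = (tofrac c%:P : Cv)%:M.
  exact: scalemx1.
have := sE M; rewrite [X in _ * X](_ : _ = 0); last first.
  by rewrite (teval_ext _ _ _ cE (frefl _)); apply: T0.
rewrite mulr0 => /esym E; rewrite -[RHS]E big_seq [RHS]big_seq.
apply: eq_bigr => e es; have /andP[_ ie] := allP sN _ es.
have hE (p : {poly CC}) : horner_alg (mv M) p = (tofrac p : Cv)%:M.
  elim/poly_ind: p => [|p c IH]; first by rewrite !rmorph0.
  rewrite rmorphD rmorphM /= IH horner_algX horner_algC cE.
  by rewrite -[_ * _]scalar_mxM -[_ + _]raddfD /= -tofracM -tofracD.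
have -> : coefv M e.1 = ((tofrac e.1.1 : Cv) * vK^-1 ^+ e.1.2)%:M.
  rewrite coefv.unlock hE [RHS]scalar_mxM; congr (_ * _).
  by elim: (e.1.2) => // k IH; rewrite !exprS IH [RHS]scalar_mxM.
rewrite -[RHS]/(_ *m _) mul_scalar_mx; congr (_ *: _).
elim: (e.2) ie => [_|y w IH /= /andP[iy iw]]; first by rewrite /word_mx /word !big_nil.
rewrite word_mx_cons word_cons IH //; congr (_ * _).
case: y iy => [[a b]|//] _ /=; rewrite /id_plus -!(inj_eq val_inj) /=.
case: ltngtP => [ab|ba|/val_inj ab]; rewrite ?raddf0 ?add0r //.
by subst b; rewrite eqxx addrC; symmetry; apply: addKr.
Qed.

Lemma sum_by_value (V : nmodType) (I T : eqType) (f : I -> T) (s : seq I) (F : I -> V) :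
  \sum_(t <- undup [seq f i | i <- s]) \sum_(i <- s | f i == t) F i = \sum_(i <- s) F i.
Proof.
under eq_bigr => t _ do rewrite big_mkcond.
rewrite exchange_big big_seq [RHS]big_seq; apply: eq_bigr => i si /=.
rewrite (bigD1_seq (f i)) ?undup_uniq //=; last by rewrite mem_undup map_f.
by rewrite eqxx big1 ?addr0 // => t; rewrite eq_sym => /negPf ->.
Qed.

Lemma in_ideal_I_in_ker_ev (n : nat) (hn : (0 < n)%N) (x : term (lgen n)) :
  in_ideal_I hn x -> in_ker_ev x.
Proof.
move=> Ix A v vi tp tm vC vvi viv rels.
have [l [s sN sE]] := term_normal_form x.
pose M := Model vC vvi viv rels.
suff s0 : \sum_(e <- s) coefv M e.1 * word M e.2 = 0.
  have [d dl] := denom_inv l M.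
  have := congr1 (fun y => d * y) (sE M).
  by rewrite s0 mulr0 mulrA dl mul1r.
(* [v^K] clears all negative powers, and [d0 w] collects the resulting polynomial coefficients of
   the word [w], which may be repeated in [s]. *)
pose K := \max_(e <- s) e.1.2; pose L := \max_(e <- s) size e.2.
have eK e : e \in s -> (e.1.2 <= K)%N by move=> es; rewrite /K (big_rem e) //= leq_maxl.
have eL e : e \in s -> (size e.2 <= L)%N by move=> es; rewrite /L (big_rem e) //= leq_maxl.
pose ws := undup [seq e.2 | e <- s].
pose d0 (w : seq (letter n)) : {poly CC} := \sum_(e <- s | e.2 == w) e.1.1 * 'X^(K - e.1.2).
have wsN : all (@normal n) ws.
  apply/allP => w; rewrite mem_undup => /mapP[e es ->]; exact: (allP sN _ es).
have wsL w : w \in ws -> (size w <= L)%N.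
  by rewrite mem_undup => /mapP[e es ->]; apply: eL.
(* The extra power of [X] gives all words the common prefactor [v^(r L)], and becomes 1 at
   [X = 1]. *)
pose G r (w : seq (letter n)) := ('X ^+ (r * (L - size w)) : {poly CC}) *: lat_word r w.
have G1 r w : map_mx (horner_eval (1 : CC)) (G r w) = lie_word (@cl_p n) (@cl_m n) r w.
  by rewrite map_mxZ /= lat_word_at1 /horner_eval hornerXn expr1n scale1r.
(* The factor [(v - 1)^(size w)] of the represented word is moved into its coefficient. *)
pose d (w : seq (letter n)) := d0 w * ('X - 1) ^+ size w.
have dG r : \sum_(w <- ws) d w *: G r w = 0.
  have N := normal_relation sN sE Ix (rtt_pair_rep n vK_neq0 r).
  have inj : injective (map_mx (@tofrac {poly CC}) : 'M_(tower_dim n.+1 r) -> _).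
    by move=> P Q /matrixP E; apply/matrixP => i j; have := E i j; rewrite !mxE => /eqP;
      rewrite tofrac_eq => /eqP.
  apply: inj; rewrite map_mx0 raddf_sum /=.
  transitivity (\sum_(w <- ws) vK ^+ (r * L) *: (tofrac (d0 w) *:
     word_mx (rep_p vK r) (rep_m vK r) w)).
    rewrite big_seq [RHS]big_seq; apply: eq_bigr => w /wsL wL.
    rewrite !map_mxZ /= !scalerA /d !rmorphM !rmorphXn rmorphB rmorph1 -/vK.
    have -> : (r * L = r * (L - size w) + r * size w)%N by rewrite -mulnDr subnK.
    by rewrite exprD [in RHS]mulrC mulrA [in LHS]mulrAC -!scalerA rep_word_lat.
  rewrite -scaler_sumr; apply/eqP; rewrite scaler_eq0; apply/orP; right; apply/eqP.
  rewrite -[RHS](scaler0 _ (vK ^+ K)) -[in RHS]N.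
  rewrite scaler_sumr -[RHS](sum_by_value snd) -/ws; apply: eq_bigr => w _.
  rewrite rmorph_sum scaler_suml /= big_seq_cond [RHS]big_seq_cond.
  apply: eq_bigr => e /andP[es /eqP <-]; rewrite scalerA rmorphM rmorphXn /= -/vK.
  congr (_ *: _); rewrite mulrCA; congr (_ * _).
  by rewrite -{2}(subnK (eK _ es)) exprD -mulrA exprVn divff ?mulr1 // expf_neq0 ?vK_neq0.
have d00 w : w \in ws -> d0 w = 0.
  move=> wws; have /eqP := word_free_at1 (@cl_coef_letter n) (@cl_kappa_neq0 n)
    (undup_uniq _) wsN G1 dG wws.
  by rewrite mulf_eq0 => /orP[/eqP //|]; rewrite expf_eq0 polyXsubC_eq0 andbF.
(* Back in the arbitrary algebra, [v] is invertible, so the relation may be multiplied by [v^K] to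
   bring in the polynomials [d0]. *)
have vK0 (y : M) : mv M ^+ K * y = 0 -> y = 0.
  move=> E; rewrite -[y]mul1r -(mqN M K%:Z) mqC -mulrA.
  by rewrite -[mq M K%:Z * y]/(mv M ^+ K * y) E mulr0.
apply: vK0; rewrite mulr_sumr -(sum_by_value snd) -/ws big_seq big1 // => w wws.
transitivity (horner_alg (mv M) (d0 w) * word M w); last by rewrite d00 // rmorph0 mul0r.
rewrite rmorph_sum mulr_suml big_seq_cond [RHS]big_seq_cond.
apply: eq_bigr => e /andP[es /eqP <-]; rewrite mulrA; congr (_ * _).
rewrite coefv.unlock mulrA -horner_mvC -mulrA [RHS]rmorphM rmorphXn /= horner_algX.
congr (_ * _); rewrite -{1}(subnK (eK _ es)) exprD -mulrA.
have E := mqN M (e.1.2)%:Z.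
have -> : mv M ^+ e.1.2 * mvi M ^+ e.1.2 = 1.
  by move: E; rewrite /mq /=; case: (e.1.2).
exact: mulr1.
Qed.

(* Ker(ev^rtt) = 𝔘^rtt_v(Lgl_n) ∩ I, as subsets of 𝔘^rtt_v(Lgl_n), whose
   elements are represented by terms. *)
Theorem theorem3p7 (n : nat) (hn : (0 < n)%N) (x : term (lgen n)) :
  in_ker_ev x <-> in_ideal_I hn x.
Proof.
by split; [apply: in_ker_ev_in_ideal_I|apply: in_ideal_I_in_ker_ev].
Qed.
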